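(* Let $Y_n=(Y_n(t))_{t\in[0,1]}$ be the normalized Quicksort-on-the-fly process and $Y=R^\emptyset$ the Quicksort process, both defined in the context. Then all finite dimensional distributions of $(Y_n(t))_{0<t\le1}$ converge to those of $(Y(t))_{0<t\le1}$: for every $k\in\mathbb N$ and all $t_1,\dots,t_k\in(0,1]$, $(Y_n(t_1),\dots,Y_n(t_k))$ converges in distribution to $(Y(t_1),\dots,Y(t_k))$ as $n\to\infty$.
   Context: Quicksort on the fly: given $n$ distinct reals, choose a pivot uniformly at random, split into the smaller elements, the pivot and the larger elements, and always recursively continue on the leftmost unfinished sublist (outputting singletons immediately), so that the elements are output in increasing order. $X(n,l)$ is the number of comparisons made until the $l$-th smallest element is identified, $1\le l\le n$. Its joint law is characterized by: $X(n,0)=0$ for all $n$, $X(0,\cdot)=X(1,\cdot)\equiv0$, and for $n\ge2$, jointly in $l=1,\dots,n$, $X(n,l)\overset{d}{=}n-1+\mathbf 1_{l<I_n}X^1(I_n-1,l)+\mathbf 1_{l\ge I_n}\big(X^1(I_n-1,I_n-1)+X^2(n-I_n,l-I_n)\big)$, where $I_n$ is uniform on $\{1,\dots,n\}$, $(X^1(j,\cdot))_j,(X^2(j,\cdot))_j$ are independent copies of $(X(j,\cdot))_j$, independent of $I_n$. Define $Y_n(t)=\big(X(n,\lfloor nt\rfloor)-E X(n,\lfloor nt\rfloor)\big)/n$ for $t\in[0,1]$. The Quicksort process $Y$: Let $V=\bigcup_{k\ge0}\{1,2\}^k$ be the binary tree of finite words over $\{1,2\}$ (root $\emptyset$, concatenation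 $vw$, $V_{<m}$ the words of length $<m$), $(U^v)_{v\in V}$ i.i.d. uniform on $[0,1]$, $C(x)=1+2x\ln x+2(1-x)\ln(1-x)$ (with $0\ln0=0$), $C(t,x)=C(x)+2\,\mathbf 1_{t<x}\big(-1+x+(1-t)\ln(1-t)-(1-x)\ln(1-x)-(x-t)\ln(x-t)\big)$. Put $\ell^v_\emptyset=1$, $\ell^v_{w1}=\ell^v_wU^{vw}$, $\ell^v_{w2}=\ell^v_w(1-U^{vw})$, $Q^v=\lim_m\sum_{w\in V_{<m}}\ell^v_wC(U^{vw})$ (a.s. and $L_2$ limit). Define maps on functions $h:[0,1]\to\mathbb R$ by $(T^v_1h)(t)=\mathbf 1_{t<U^v}U^vh(1\wedge t/U^v)$, $(T^v_2h)(t)=\mathbf 1_{t\ge U^v}(1-U^v)h\big(0\vee\frac{t-U^v}{1-U^v}\big)$, $C^v(t)=C(t,U^v)+\mathbf 1_{t\ge U^v}U^vQ^{v1}$, $L^v_\emptyset=\mathrm{id}$, $L^v_{wi}=L^v_w\circ T^{vw}_i$, $R^v_m=\sum_{w\in V_{<m}}L^v_w(C^{vw})$. Then $R^\emptyset_m$ converges a.s. uniformly on $[0,1]$ to a càdlàg random function $R^\emptyset$, and $Y:=R^\emptyset$. *)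

(* Defs.v *)
From HB Require Import structures.
From mathcomp Require Import all_boot all_order all_algebra.
From mathcomp Require Import all_classical all_reals all_analysis.

Set Implicit Arguments.
Unset Strict Implicit.
Unset Printing Implicit Defensive.
Import Order.TTheory GRing.Theory Num.Theory.
Import numFieldNormedType.Exports.
Local Open Scope classical_set_scope.
Local Open Scope ring_scope.

(* Binary tree of words over {1,2}: we encode 1 as false and 2 as true;
   the root is [::], concatenation vw is v ++ w, child vi is rcons v i. *)
Definition word := seq bool.

Section QuicksortDefs.
Variable R : realType.

Definition xlnx (x : R) : R := if x == 0 then 0 else x * ln x.

Definition Cf (x : R) : R := 1 + 2 * xlnx x + 2 * xlnx (1 - x).

Definition Ctx (t x : R) : R :=
  Cf x + 2 * (if t < x then
    -1 + x + xlnx (1 - t) - xlnx (1 - x) - xlnx (x - t) else 0).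

(* Given a labelling u of the tree by points of [0,1] (a realisation of (U^v)_v). *)
Variable u : word -> R.

(* pivot rank at node v for a sublist of size n: I = floor(n U^v) + 1,
   which is uniform on {1,..,n} when U^v is uniform on [0,1]
   (the minn only affects the null event U^v = 1). *)
Definition pivot (v : word) (n : nat) : nat := minn n (Num.truncn (n%:R * u v)).+1.

(* X on the subtree rooted at v; m is fuel (m >= n suffices). The left
   recursive call uses the subtree v1, the right one uses v2, so that the two
   copies X^1, X^2 are independent and independent of the pivot. *)
Fixpoint Xf (m : nat) (v : word) (n l : nat) : nat :=
  match m with
  | 0 => 0
  | m'.+1 =>
    if ((n <= 1) || (l == 0))%N then 0 else
    let I := pivot v n in
    (n - 1)%N +
    (if (l < I)%N then Xf m' (rcons v false) I.-1 l
     else Xf m' (rcons v false) I.-1 I.-1 + Xf m' (rcons v true) (n - I) (l - I))%N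
  end.

Definition Xq (n l : nat) : nat := Xf n [::] n l.

(* ell^v_w : ell^v_[] = 1, ell^v_{w1} = ell^v_w U^{vw}, ell^v_{w2} = ell^v_w (1-U^{vw}),
   written here by recursion on the first letter (same product along the path). *)
Fixpoint ell (v : word) (w : word) : R :=
  match w with
  | [::] => 1
  | b :: w' => (if b then 1 - u v else u v) * ell (rcons v b) w'
  end.

Definition sumVlt (m : nat) (F : word -> R) : R :=
  \sum_(j < m) \sum_(w : j.-tuple bool) F (tval w).

Definition Qpart (v : word) (m : nat) : R :=
  sumVlt m (fun w => ell v w * Cf (u (v ++ w))).

Definition Qv (v : word) : R := limn (Qpart v).

Definition Top (v : word) (b : bool) (h : R -> R) : R -> R :=
  fun t =>
  if ~~ b then (if t < u v then u v * h (Num.min 1 (t / u v)) else 0)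
  else (if u v <= t then (1 - u v) * h (Num.max 0 ((t - u v) / (1 - u v))) else 0).

Definition Cv (v : word) (t : R) : R :=
  Ctx t (u v) + (if u v <= t then u v * Qv (rcons v false) else 0).

(* L^v_[] = id, L^v_{wi} = L^v_w o T^{vw}_i (recursion on the first letter) *)
Fixpoint Lop (v : word) (w : word) : (R -> R) -> (R -> R) :=
  match w with
  | [::] => id
  | b :: w' => fun h => Top v b (Lop (rcons v b) w' h)
  end.

Definition Rm (v : word) (m : nat) (t : R) : R :=
  sumVlt m (fun w => Lop v w (Cv (v ++ w)) t).

Definition Yproc (t : R) : R := limn (fun m => Rm [::] m t).

End QuicksortDefs.

Local Open Scope ereal_scope.

Definition iid_uniform d (T : measurableType d) (R : realType)
  (P : probability T R) (U : word -> T -> R) : Prop :=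
  (forall v, measurable_fun setT (U v)) /\
  (forall v (B : set R), measurable B ->
      P (U v @^-1` B) = lebesgue_measure (B `&` `[0%R, 1%R]%classic)) /\
  (forall (s : seq word) (B : word -> set R), uniq s ->
      (forall v, measurable (B v)) ->
      P (\bigcap_(v in [set` s]) (U v @^-1` B v)) =
      \prod_(v <- s) P (U v @^-1` B v)).

Definition cvg_in_distribution d (T : measurableType d) (R : realType)
  (P : probability T R) (k : nat)
  (Zn : nat -> T -> 'rV[R]_k) (Z : T -> 'rV[R]_k) : Prop :=
  forall f : 'rV[R]_k -> R, continuous f ->
    (exists M : R, forall x, (`|f x| <= M)%R) ->
    ('E_P[f \o Zn n] @[n --> \oo] --> 'E_P[f \o Z]).

Definition Yn d (T : measurableType d) (R : realType)
  (P : probability T R) (U : word -> T -> R) (n : nat) (t : R) : T -> R :=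
  let l := Num.truncn (n%:R * t)%R in
  let Xnl := fun x => ((Xq (fun v => U v x) n l)%:R : R) in
  fun x => ((Xnl x - fine 'E_P[Xnl]) / n%:R)%R.

Definition Yq (R : realType) d (T : measurableType d) (U : word -> T -> R) (t : R) : T -> R :=
  fun x => Yproc (fun v => U v x) t.

(* Main.v *)
(** Both processes are functions of the same labels [U]; we prove
    E|Y_n(t) - Y(t)| -> 0 for every t in (0,1].

    Write b(n,l) for the mean of X(n,l), which has a closed form in harmonic
    numbers.  Unfolding the recursion, X(n,l) - b(n,l) is the sum over the nodes
    w of tolls D_w, where D_w is a function of the state of w (length of its
    sublist, number of its elements still wanted) and of its own pivot, has mean
    zero given the state, and is bounded by a constant times the length.  Tolls
    of different nodes are thus orthogonal, and since the sum of the squared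
    lengths shrinks in mean by 2/3 at each level, the tolls below level m
    contribute at most C (5/6)^m to Y_n(t) in L1, uniformly in n.

    For a fixed node, D_w / n converges almost surely to the corresponding term
    of the expansion of Y(t), unless the target rank sits exactly at a split
    point; this has probability zero because l_w / n_w converges and is
    independent of U_w.  By Fatou's lemma the tail bounds pass to the limit.
    They give the almost sure convergence of Q^v, of R_m(t), which is the limit
    over M of the sum of the limit tolls of a subtree truncated at level M, and
    the L1 distance of Y(t) to its first m levels. *)
Require Import Defs.
From HB Require Import structures.
From mathcomp Require Import all_boot all_order all_algebra.
From mathcomp Require Import all_classical all_reals all_analysis.
From mathcomp Require Import measurable_realfun.
From mathcomp Require Import ring lra zify.
Set Implicit Arguments.
Unset Strict Implicit.
Unset Printing Implicit Defensive.
Import Order.TTheory GRing.Theory Num.Theory.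
Import numFieldNormedType.Exports.
Local Open Scope classical_set_scope.
Local Open Scope ring_scope.

(** * The mean number of comparisons *)

(** The truncations in the definition of [Y] do not follow the depth of the tree: at a right turn
    [Cv] contains, through [Qv], the whole infinite left subtree, so [Rm] is not a sum of limit
    tolls over the first levels. The flags bridge this gap. They discard nodes as a function of the
    state alone, so flagged tolls stay centred and orthogonal, and one tail bound serves both
    truncations. No moment of [Cf] or [Ctx] is computed: all estimates on the limit are inherited
    from finite lists. A second obstacle is the jump of the mean at rank zero, where X(n,0) = 0
    although [Ctx 0 y] does not vanish. A rank whose limit is zero must therefore vanish exactly for
    large n, which holds when no split point is hit. The same jump makes the limit fail at t = 0.
    Since both processes live on one probability space, L1 convergence for each single t already
    yields joint convergence. The rate 5/6 is a rational upper bound for the square root of 2/3. *)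

Section MeanComparisons.
Variable R : realType.

(** Closes the side conditions of [field]: every natural number in the goal is recorded as
    nonnegative, after which positivity of the denominators is linear. *)
Ltac natr_nz := try done; repeat (apply/andP; split); apply: lt0r_neq0;
  repeat match goal with |- context [GRing.natmul (GRing.one _) ?n] =>
    lazymatch goal with
    | H : is_true (0 <= n%:R) |- _ => fail
    | |- _ => have := ler0n R n; move=> ?
    end end; lra.

Definition harm (n : nat) : R := \sum_(j < n) j.+1%:R^-1.

Lemma harm0 : harm 0 = 0.
Proof. by rewrite /harm big_ord0. Qed.

Lemma harmS n : harm n.+1 = harm n + n.+1%:R^-1.
Proof. by rewrite /harm big_ord_recr. Qed.

(* Closed form of [E X(n,l)]; it jumps at [l = 0], where [X(n,0) = 0]. *)
Definition mean_cmp (n l : nat) : R :=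
  if l == 0%N then 0 else
  2 * n%:R + 2 * n.+1%:R * harm n - 2 * (n.+3%:R - l%:R) * harm (n.+1 - l)
  - 6 * l%:R + 6.

Lemma mean_cmp0 n : mean_cmp n 0 = 0.
Proof. by []. Qed.

(** The classical mean of Quicksort on the whole list. It also holds for [n = 0], so completely
    sorted sublists need no case distinction. *)
Lemma mean_cmpnn n : mean_cmp n n = 2 * n.+1%:R * harm n - 4 * n%:R.
Proof.
case: n => [|n]; first by rewrite /mean_cmp /= harm0; ring.
rewrite /mean_cmp /= subSnn [harm 1]harmS harm0 -!natr1; field; natr_nz.
Qed.

Lemma sum_mean_cmp_diag l :
  \sum_(j < l) mean_cmp j j =
  l%:R * l.+1%:R * harm l - l%:R * (l%:R + 3) / 2 - 2 * l%:R * (l%:R - 1).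
Proof.
elim: l => [|l IH]; first by rewrite big_ord0; ring.
rewrite big_ord_recr /= IH mean_cmpnn harmS -!natr1; field; natr_nz.
Qed.

(** Discrete antiderivative of the dominant term of the mean:
    [G x.+1 - G x = 2 * x.+1%:R * harm R x]. *)
Let G (x : nat) : R := x%:R * x.+1%:R * harm x - x%:R * (x%:R + 3) / 2.

Lemma sum_mean_cmp_left l m :
  \sum_(k < m) mean_cmp (l.+1 + k) l.+1 =
  2 * l.+1%:R * m%:R + m%:R * (m%:R - 1) + G (l.+1 + m) - G l.+1
  - (G m.+1 + 2 * (m.+1%:R * harm m - m%:R)) - 6 * l%:R * m%:R.
Proof.
elim: m => [|m IH].
  by rewrite big_ord0 addn0 /G !harmS harm0 -!natr1; field.
rewrite big_ord_recr /= IH /mean_cmp /=.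
have -> : ((l.+1 + m).+1 - l.+1 = m.+1)%N by lia.
rewrite addnS /G !harmS !(natrD,=^~natr1) ?harmS; field; natr_nz.
Qed.

Lemma sum_mean_cmp_right d l :
  \sum_(j < l) mean_cmp (d + j.+1) j.+1 =
  2 * d%:R * l%:R + l%:R * (l%:R + 1) + G (d + l).+1 - G d.+1
  - 2 * (d%:R + 3) * l%:R * harm d.+1 - 3 * l%:R * (l%:R + 1) + 6 * l%:R.
Proof.
elim: l => [|l IH].
  by rewrite big_ord0 addn0 /G; field.
rewrite big_ord_recr /= IH /mean_cmp /=.
have -> : ((d + l.+1).+1 - l.+1 = d.+1)%N by lia.
rewrite !addnS /G !harmS !(natrD,=^~natr1) ?harmS; field; natr_nz.
Qed.

(** The recursion of the mean over a uniform pivot rank [i], multiplied by [n]. As rank zero costs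
    nothing, [minn] and truncated subtraction merge its two cases. It is what makes the tolls
    centred. *)
Lemma sum_mean_cmp n l : (0 < l <= n)%N ->
  \sum_(1 <= i < n.+1) (mean_cmp i.-1 (minn l i.-1) + mean_cmp (n - i) (l - i))
  = n%:R * (mean_cmp n l - (n%:R - 1)).
Proof.
case: l => [//|l] /= ln; have [d ->] : {d | n = (l.+1 + d)%N}.
  by exists (n - l.+1)%N; rewrite subnKC.
rewrite big_add1 /= big_split /=.
(* The index is now the number of elements below the pivot. Up to [l] of them, the left list is
   sorted completely; beyond, [l.+1] of its elements are wanted. The right list contributes only for
   indices below [l]. *)
rewrite [X in X + _](@big_cat_nat _ _ _ l.+1) ?leq_addr //=.
rewrite [X in X + _ + _](_ : _ = \sum_(j < l.+1) mean_cmp j j); last first.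
  by rewrite big_mkord; apply: eq_bigr => i _; rewrite (minn_idPr _) // ltnW.
rewrite [X in _ + X + _](_ : _ = \sum_(k < d) mean_cmp (l.+1 + k) l.+1); last first.
  rewrite -{1}[l.+1]add0n big_addn addKn big_mkord; apply: eq_bigr => i _.
  by rewrite addnC (minn_idPl _) // leq_addr.
rewrite [X in _ + _ + X](_ : _ = \sum_(j < l) mean_cmp (d + j.+1) j.+1); last first.
  rewrite (@big_cat_nat _ _ _ l) //=; last by lia.
  rewrite [X in _ + X]big_nat_cond [X in _ + X]big1 ?addr0; last first.
    by move=> i /andP[/andP[li _] _]; rewrite (_ : (l.+1 - i.+1 = 0)%N)//; lia.
  rewrite big_nat_rev /= big_mkord; apply: eq_bigr => i _; have := ltn_ord i => il.
  by congr mean_cmp; lia.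
rewrite sum_mean_cmp_diag sum_mean_cmp_left sum_mean_cmp_right.
have -> : ((d + l).+1 = l.+1 + d)%N by lia.
rewrite /mean_cmp /= (_ : ((l + d).+2 - l.+1 = d.+1)%N); last by lia.
rewrite !addSn /G !harmS !(natrD,=^~natr1) ?harmS; field; natr_nz.
Qed.

End MeanComparisons.

(** * Decomposition of the number of comparisons into tolls *)

Section TreeSums.
Variable R : realType.

Lemma big_tuple_cons (F : word -> R) j :
  \sum_(w : j.+1.-tuple bool) F w =
  \sum_(w : j.-tuple bool) F (false :: w) + \sum_(w : j.-tuple bool) F (true :: w).
Proof.
rewrite (reindex (fun p : bool * j.-tuple bool => [tuple of p.1 :: p.2])) /=; last first.
  exists (fun w : j.+1.-tuple bool => (thead w, [tuple of behead w])) => [[b w] _|w _] /=.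
    by congr (_, _); apply/val_inj.
  by rewrite [RHS]tuple_eta.
by rewrite -(pair_bigA _ (fun b (w : j.-tuple bool) => F (b :: w))) big_bool addrC.
Qed.

Lemma big_tuple_rcons (F : word -> R) j :
  \sum_(w : j.+1.-tuple bool) F w =
  \sum_(w : j.-tuple bool) F (rcons w false) + \sum_(w : j.-tuple bool) F (rcons w true).
Proof.
elim: j F => [|j IH] F.
  by rewrite big_tuple_cons; congr (_ + _); apply: eq_bigr => w _; rewrite [w]tuple0.
rewrite big_tuple_cons (IH (fun w => F (false :: w))) (IH (fun w => F (true :: w))).
rewrite (big_tuple_cons (fun w => F (rcons w false))).
by rewrite (big_tuple_cons (fun w => F (rcons w true))) addrACA.
Qed.

Lemma sumVlt0 (F : word -> R) : sumVlt 0 F = 0.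
Proof. by rewrite /sumVlt big_ord0. Qed.

Lemma sumVltS m (F : word -> R) :
  sumVlt m.+1 F =
  F [::] + sumVlt m (fun w => F (false :: w)) + sumVlt m (fun w => F (true :: w)).
Proof.
rewrite /sumVlt big_ord_recl -addrA; congr (_ + _).
  by rewrite (big_pred1 [tuple]) // => w; apply/esym/eqP; exact: tuple0.
by rewrite -big_split; apply: eq_bigr => j _; rewrite big_tuple_cons.
Qed.

(** Recursion on the first letter, passing to the labels of the subtree, matches the unfolding
    [sumVltS]; [run_rcons] gives the last-letter form needed for induction on depth. *)
Fixpoint run (S : Type) (step : R -> bool -> S -> S) (u : word -> R) (s : S)
    (w : word) : S :=
  match w with
  | [::] => s
  | b :: w' => run step (fun w => u (b :: w)) (step (u [::]) b s) w'
  end.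

Lemma run_rcons S (step : R -> bool -> S -> S) u s w b :
  run step u s (rcons w b) = step (u w) b (run step u s w).
Proof. by elim: w u s => [//|a w IH] u s /=; rewrite IH. Qed.

End TreeSums.

(** * States of sublists, tolls, and the linear bound on a toll *)

Section DiscreteStates.
Variable R : realType.
Implicit Types (u : word -> R) (n l i : nat).

Definition piv n (y : R) : nat := minn n (Num.truncn (n%:R * y)).+1.

Lemma piv_le n y : (piv n y <= n)%N.
Proof. exact: geq_minl. Qed.

Lemma piv_gt0 n y : (0 < n)%N -> (0 < piv n y)%N.
Proof. by move=> n0; rewrite /piv leq_min n0. Qed.

(* Flags restrict the tree to the nodes seen by [R_m]: [None] means no
   restriction, [Some k] a node whose sublist contains the target rank and below
   which [k] more such nodes are kept; a completely sorted left sublist is kept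
   in full, and [Some 0] marks discarded nodes. *)
Definition dec_flag (f : option nat) := if f is Some k then Some k.-1 else None.
Definition full_flag (f : option nat) := if f is Some 0%N then Some 0%N else None.
Definition live (f : option nat) := f != Some 0%N.

(* [(n, l, f)]: a sublist of length [n] of which the [l] smallest are wanted. *)
Definition dstate := (nat * nat * option nat)%type.

Definition dsplit (i : nat) (b : bool) (s : dstate) : dstate :=
  let: (n, l, f) := s in
  if b then (n - i, l - i, dec_flag f)%N
  else (i.-1, minn l i.-1, if (l < i)%N then dec_flag f else full_flag f).

Definition dstep (y : R) (b : bool) (s : dstate) : dstate := dsplit (piv s.1.1 y) b s.

(** Change in the conditional mean of the cost of a sublist when its pivot rank [i] is revealed.
    Lists that need no comparison and discarded nodes get zero. *)
Definition dtoll (s : dstate) (i : nat) : R :=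
  let: (n, l, f) := s in
  if [|| (n <= 1)%N, l == 0%N | ~~ live f] then 0 else
  n%:R - 1 + mean_cmp R i.-1 (minn l i.-1) + mean_cmp R (n - i) (l - i) - mean_cmp R n l.

Definition dterm u s w : R :=
  let s' := run dstep u s w in dtoll s' (piv s'.1.1 (u w)).

Lemma sum_dtermS M u s :
  sumVlt M.+1 (dterm u s) = dtoll s (piv s.1.1 (u [::])) +
    sumVlt M (dterm (fun w => u (false :: w)) (dstep (u [::]) false s)) +
    sumVlt M (dterm (fun w => u (true :: w)) (dstep (u [::]) true s)).
Proof. exact: sumVltS. Qed.

Lemma Xf0 u M v n : Xf u M v n 0 = 0%N.
Proof. by case: M => //= M; rewrite orbT. Qed.

Lemma Xf1 u M v n l : (n <= 1)%N -> Xf u M v n l = 0%N.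
Proof. by case: M => //= M ->. Qed.

(** A call with rank zero returns zero, so both cases of the definition become one formula with a
    left and a right call. *)
Lemma XfS u M v n l :
  Xf u M.+1 v n l = ((if (n <= 1)%N || (l == 0%N) then 0 else n - 1) +
     (Xf u M (rcons v false) (piv n (u v)).-1 (minn l (piv n (u v)).-1) +
      Xf u M (rcons v true) (n - piv n (u v)) (l - piv n (u v))))%N.
Proof.
rewrite [LHS]/= -[pivot u v n]/(piv n (u v)); have := piv_le n (u v); have := @piv_gt0 n (u v).
set I := piv _ _ => I0 In.
case: ifP => [/orP[n1|/eqP l0]|/negbT].
- by rewrite !Xf1 //; lia.
- by rewrite l0 min0n sub0n (Xf0 _ _ _ I.-1) (Xf0 _ _ _ (n - I)).
rewrite negb_or -ltnNge => /andP[n1 l0].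
congr addn; case: ltnP => lI.
  have -> : (l - I = 0)%N by lia.
  have /minn_idPl -> : (l <= I.-1)%N by lia.
  by rewrite (Xf0 _ _ _ (n - I)) addn0.
by have /minn_idPr -> : (I.-1 <= l)%N by lia.
Qed.

Lemma mean_cmp_small n l : (l <= n)%N -> (n <= 1)%N -> mean_cmp R n l = 0.
Proof.
case: l n => [//|l] [//|n] ln n1; have -> : n = l by lia.
by rewrite mean_cmpnn (_ : l = 0%N); last (by lia); rewrite harmS harm0; field.
Qed.

Lemma Xf_tolls u M v n l : (l <= n <= M)%N ->
  (Xf u M v n l)%:R =
  mean_cmp R n l + sumVlt M (dterm (fun w => u (v ++ w)) (n, l, None)).
Proof.
elim: M v n l => [|M IH] v n l /andP[ln nM].
  by rewrite sumVlt0 mean_cmp_small //=; [rewrite addr0|lia].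
have shift b : (fun w => u (v ++ b :: w)) = (fun w => u (rcons v b ++ w)).
  by apply/funext => w; rewrite cat_rcons.
rewrite XfS sum_dtermS !shift /dstep /= !cats0.
have := piv_le n (u v); have := @piv_gt0 n (u v); set I := piv _ _ => I0 In.
rewrite !natrD !IH; [|lia..].
rewrite if_same; case: ifP => [/orP[n1|/eqP l0]|/negbT].
- rewrite !mean_cmp_small; [|lia..]; by rewrite n1 /=; ring.
- by rewrite l0 min0n sub0n !mean_cmp0 orbT /=; ring.
rewrite negb_or -ltnNge => /andP[n1 l0].
rewrite leqNgt n1 (negPf l0) /= natrB; last by lia.
by ring.
Qed.

(** Fuel beyond [n] does not change [Xf], so the depth [M] may later be taken larger than any
    prescribed level. *)
Lemma Xq_tolls u n l M : (l <= n <= M)%N ->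
  (Xq u n l)%:R = mean_cmp R n l + sumVlt M (dterm u (n, l, None)).
Proof.
move=> /andP[ln nM]; rewrite -(@Xf_tolls u M [::]) ?ln //; congr (_%:R).
have Xf_fuel m m' v n' l' : (n' <= m)%N -> (n' <= m')%N ->
    Xf u m v n' l' = Xf u m' v n' l'.
  elim: m m' v n' l' => [|m IH] [|m'] v n' l' nm nm'; last 1 first.
  - rewrite !XfS; have := piv_le n' (u v); have := @piv_gt0 n' (u v).
    case: (posnP n') => [n0|n0] I0 In; first by rewrite !Xf1 //; lia.
    by rewrite !(IH m') //; have := I0 isT; lia.
  - by [].
  - by rewrite !Xf1 //; lia.
  - by rewrite !Xf1 //; lia.
by rewrite /Xq; apply: Xf_fuel.
Qed.

Lemma harm_ge0 n : 0 <= harm R n.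
Proof. by rewrite sumr_ge0. Qed.

(** For [k > 0] each of the [n - k] terms of the difference is at most [1 / k]. Logarithmic factors
    of sublists of different lengths are thus exchanged at linear cost. *)
Lemma harm_gap k n : (k <= n)%N ->
  0 <= harm R n - harm R k /\ k%:R * (harm R n - harm R k) <= n%:R - k%:R.
Proof.
elim: n => [|n IH]; first by case: k => // _; rewrite subrr mulr0 lexx.
rewrite leq_eqVlt ltnS => /predU1P[->|kn]; first by rewrite !subrr mulr0.
have [h1 h2] := IH kn; have n0 : 0 < n.+1%:R :> R by rewrite ltr0n.
have i0 : 0 <= n.+1%:R^-1 :> R by rewrite invr_ge0 ltW.
split; first by rewrite harmS addrAC addr_ge0.
rewrite harmS [_ + _ - _]addrAC mulrDr -[in n.+1%:R - _]natr1 [X in _ <= X]addrAC.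
by rewrite lerD // ler_pdivrMr // mul1r ler_nat; lia.
Qed.

Lemma harm_le n : harm R n <= n%:R.
Proof.
elim: n => [|n IH]; first by rewrite harm0.
by rewrite harmS -[leRHS]natr1 lerD // invf_le1 ?ler1n ?ltr0n.
Qed.

(** The superlinear part of the mean is [2 * l * harm n], with the same factor [harm n] for all
    sublists of a list of length [n]. Being linear in the number of wanted elements, it nearly
    cancels in a toll. *)
Lemma mean_cmp_bound n a l : (0 < n)%N -> (l <= a <= n)%N ->
  `|mean_cmp R a l - 2 * l%:R * harm R n| <= 24 * n%:R.
Proof.
move=> n0 /andP[la an]; rewrite /mean_cmp; case: eqP => [->|/eqP l0].
  by rewrite mulr0 mul0r subr0 normr0 mulr_ge0.
have q : (a.+1 - l <= n)%N by lia.
have [a1 a2] := harm_gap an; have [q1 q2] := harm_gap q.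
have := harm_ge0 n; have := harm_ge0 a; have := harm_ge0 (a.+1 - l).
have := harm_le n; have := harm_le (a.+1 - l).
have : (a.+1 - l)%:R = a%:R + 1 - l%:R :> R by rewrite natrB ?natr1 //; lia.
set q' := (a.+1 - l)%N in q q1 q2 *.
have e1 : 0 <= a%:R * (harm R n - harm R a) by rewrite mulr_ge0.
have e2 : 0 <= q'%:R * (harm R n - harm R q') by rewrite mulr_ge0.
have : q'%:R <= n%:R :> R by rewrite ler_nat.
have : a%:R <= n%:R :> R by rewrite ler_nat.
have : l%:R <= a%:R :> R by rewrite ler_nat.
have : 1 <= n%:R :> R by rewrite ler1n.
have : 1 <= l%:R :> R by rewrite ler1n; lia.
rewrite -[a.+3%:R]/((3 + a)%:R) -[a.+1%:R]/((1 + a)%:R) !natrD.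
move=> l1 n1 la' an' qn' qE hq hn hq0 ha0 hn0.
rewrite [X in `|X|](_ : _ = 2 * a%:R - 2 * harm R n
    - 2 * (a%:R * (harm R n - harm R a)) + 2 * harm R a
    + 2 * (q'%:R * (harm R n - harm R q')) - 4 * harm R q' - 6 * l%:R + 6); last first.
  by rewrite qE; ring.
set x1 := a%:R * _ in a2 e1 *; set x2 := q'%:R * _ in q2 e2 *.
by rewrite ler_norml; apply/andP; split; lra.
Qed.

Lemma dtoll_bound s i : (s.1.2 <= s.1.1)%N -> (0 < i <= s.1.1)%N ->
  `|dtoll s i| <= 75 * s.1.1%:R.
Proof.
case: s => [[n l] f] /= ln /andP[i0 il].
case: ifP => [_|/negbT]; first by rewrite normr0 mulr_ge0.
rewrite !negb_or => /and3P[n1 l0 _].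
have n0 : (0 < n)%N by lia.
have Ha : (minn l i.-1 <= i.-1 <= n)%N by lia.
have Hb : (l - i <= n - i <= n)%N by lia.
have Hc : (l <= n <= n)%N by lia.
move: (mean_cmp_bound n0 Ha) (mean_cmp_bound n0 Hb) (mean_cmp_bound n0 Hc).
rewrite !ler_norml => /andP[a1 a2] /andP[b1 b2] /andP[c1 c2].
have hn := harm_le n; have hn0 := harm_ge0 n.
have n1' : 1 <= n%:R :> R by rewrite ler1n.
(* The wanted elements of the two sublists add up to [l], or to [l - 1] when the pivot itself is
   wanted. Hence 75 = 3 * 24 + 1 + 2: three means, the [n - 1] comparisons, and at most one leftover
   [2 * harm n <= 2 * n]. *)
have : (minn l i.-1 + (l - i) = l \/ minn l i.-1 + (l - i) + 1 = l)%N by lia.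
rewrite -!mulrA in a1 a2 b1 b2 c1 c2.
case=> /(congr1 (fun k => k%:R * harm R n : R)); rewrite !(natrD, mulrDl) ?mul1r.
all: set x1 := _ * harm R n in a1 a2 *; set x2 := _ * harm R n in b1 b2 *.
all: set x3 := _ * harm R n in c1 c2 *.
all: by move=> E; apply/andP; split; lra.
Qed.

End DiscreteStates.

(** * Independence and orthogonality of the tolls *)

Section BoundedExpectation.
Context d (T : measurableType d) (R : realType) (P : probability T R).
Implicit Types (X Y : T -> R).

(** Functions of finitely many discrete states fall in this class, which settles the integrability
    conditions of the discrete part. *)
Definition bmf X := measurable_fun setT X /\ exists M, forall x, `|X x| <= M.

Definition Ex X : R := \int[P]_x X x.
Definition Pr (A : set T) : R := fine (P A).

Lemma bmf_integrable X : bmf X -> P.-integrable setT (EFin \o X).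
Proof.
move=> [mX [M XM]]; apply: measurable_bounded_integrable => //.
  by rewrite (le_lt_trans (probability_le1 P measurableT)) ?ltry.
exists M; split; first exact: num_real.
by move=> y My x _; exact: le_trans (XM x) (ltW My).
Qed.

Lemma bmf_cst c : bmf (cst c).
Proof. by split => //; exists `|c|. Qed.

Lemma bmfD X Y : bmf X -> bmf Y -> bmf (fun x => X x + Y x).
Proof.
move=> [mX [M XM]] [mY [N YN]]; split; first exact: measurable_funD.
by exists (M + N) => x; rewrite (le_trans (ler_normD _ _)) ?lerD.
Qed.

Lemma bmfM X Y : bmf X -> bmf Y -> bmf (fun x => X x * Y x).
Proof.
move=> [mX [M XM]] [mY [N YN]]; split; first exact: measurable_funM.
by exists (M * N) => x; rewrite normrM ler_pM.
Qed.

Lemma bmfZ c X : bmf X -> bmf (fun x => c * X x).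
Proof. exact/bmfM/bmf_cst. Qed.

Lemma bmf_sum (I : Type) (s : seq I) (X : I -> T -> R) :
  (forall i, bmf (X i)) -> bmf (fun x => \sum_(i <- s) X i x).
Proof.
move=> bX; elim: s => [|i s IH].
  by under eq_fun do rewrite big_nil; exact: bmf_cst.
by under eq_fun do rewrite big_cons; exact: bmfD.
Qed.

Lemma bmf_abs X : bmf X -> bmf (fun x => `|X x|).
Proof.
move=> [mX [M XM]]; split; first exact: measurableT_comp.
by exists M => x; rewrite normr_id.
Qed.

Lemma bmf_indic A : measurable A -> bmf (\1_A).
Proof.
move=> mA; split; first exact: measurable_indic.
by exists 1 => x; rewrite indicE; case: (x \in A); rewrite ?normr1 ?normr0 ?ler01.
Qed.

Lemma ExD X Y : bmf X -> bmf Y -> Ex (fun x => X x + Y x) = Ex X + Ex Y.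
Proof. by move=> bX bY; rewrite /Ex RintegralD //; exact: bmf_integrable. Qed.

Lemma ExZ c X : bmf X -> Ex (fun x => c * X x) = c * Ex X.
Proof. by move=> bX; rewrite /Ex RintegralZl //; exact: bmf_integrable. Qed.

Lemma Ex_cst c : Ex (cst c) = c.
Proof.
rewrite /Ex Rintegral_cst // [X in fine X](_ : _ = 1%E) ?mulr1 //.
exact: probability_setT.
Qed.

Lemma Ex_sum (I : Type) (s : seq I) (X : I -> T -> R) :
  (forall i, bmf (X i)) ->
  Ex (fun x => \sum_(i <- s) X i x) = \sum_(i <- s) Ex (X i).
Proof.
move=> bX; elim: s => [|i s IH].
  by under [X in Ex X]eq_fun do rewrite big_nil; rewrite big_nil Ex_cst.
under [X in Ex X]eq_fun do rewrite big_cons.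
by rewrite big_cons -IH ExD //; exact: bmf_sum.
Qed.

Lemma Ex_le X Y : bmf X -> bmf Y -> (forall x, X x <= Y x) -> Ex X <= Ex Y.
Proof. by move=> bX bY XY; apply: le_Rintegral => //; exact: bmf_integrable. Qed.

Lemma Ex_indic A : measurable A -> Ex (\1_A) = Pr A.
Proof. by move=> mA; rewrite /Ex /Rintegral integral_indic // setIT. Qed.

Lemma Ex_EFin X : bmf X -> (\int[P]_x (X x)%:E = (Ex X)%:E)%E.
Proof.
move=> bX; rewrite /Ex /Rintegral fineK //.
by apply: integrable_fin_num => //; exact: bmf_integrable.
Qed.

End BoundedExpectation.

Section Independence.
Context d (T : measurableType d) (R : realType) (P : probability T R).
Variable U : word -> T -> R.
Hypothesis UP : iid_uniform P U.
Implicit Types (X Y Z : T -> R) (w v : word).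
Local Notation Ex := (Ex P).
Local Notation Pr := (Pr P).

Let mU v : measurable_fun setT (U v). Proof. by have [+ _] := UP; exact. Qed.

Lemma measurable_label v (B : set R) : measurable B -> measurable (U v @^-1` B).
Proof. by move=> mB; rewrite -[X in measurable X]setTI; exact: mU. Qed.

Lemma bmf_label v (B : set R) : measurable B -> bmf (fun x => \1_B (U v x) : R).
Proof.
move=> mB; split; last by exists 1 => x; rewrite indicE; case: (_ \in _); rewrite ?normr1 ?normr0.
by apply: measurableT_comp => //; exact: measurable_indic.
Qed.

Definition cylinder (s : seq word) (B : word -> set R) : set T :=
  \bigcap_(v in [set` s]) (U v @^-1` B v).

Lemma measurable_cylinder s B : (forall v, measurable (B v)) -> measurable (cylinder s B).
Proof.
by move=> mB; apply: fin_bigcap_measurable => // v _; exact: measurable_label.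
Qed.

(* Functions of finitely many labels other than [U w]; being syntactic, closure
   under products and independence of [U w] are proved by induction. *)
Inductive nodep w : (T -> R) -> Prop :=
| nodep_cylinder s B : w \notin s -> (forall v, measurable (B v)) ->
    nodep w (\1_(cylinder s B))
| nodepD X Y : nodep w X -> nodep w Y -> nodep w (fun x => X x + Y x)
| nodepZ c X : nodep w X -> nodep w (fun x => c * X x).

Lemma nodep_bmf w X : nodep w X -> bmf X.
Proof.
elim=> [s B _ mB|Y Z _ bY _ bZ|c Y _ bY]; [|exact: bmfD|exact: bmfZ].
exact/bmf_indic/measurable_cylinder.
Qed.

Lemma nodep_cst w c : nodep w (cst c).
Proof.
have := @nodepZ w c _ (@nodep_cylinder w [::] (fun=> setT) isT (fun=> measurableT)).
congr nodep; apply/funext => x; rewrite /cylinder indicE mem_set ?mulr1 //.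
Qed.

Lemma nodep_sum w (I : Type) (s : seq I) (X : I -> T -> R) :
  (forall i, nodep w (X i)) -> nodep w (fun x => \sum_(i <- s) X i x).
Proof.
move=> nX; elim: s => [|i s IH].
  by under eq_fun do rewrite big_nil; exact: nodep_cst.
by under eq_fun do rewrite big_cons; exact: nodepD.
Qed.

Lemma nodep_label w v (B : set R) : w != v -> measurable B ->
  nodep w (fun x => \1_B (U v x)).
Proof.
move=> wv mB.
have := @nodep_cylinder w [:: v] (fun=> B) _ (fun=> mB).
rewrite inE => /(_ wv); congr nodep; apply/funext => x.
rewrite /cylinder !indicE; congr (nat_of_bool _)%:R; apply/idP/idP; rewrite !inE /=.
  by move=> /(_ v); apply; rewrite /= inE.
by move=> Bx v' /=; rewrite inE => /eqP ->.
Qed.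

Lemma nodepM w X Y : nodep w X -> nodep w Y -> nodep w (fun x => X x * Y x).
Proof.
elim=> [s B ws mB|X1 X2 _ IH1 _ IH2|c X1 _ IH1] nY; last 2 first.
- have := nodepD (IH1 nY) (IH2 nY); congr nodep; apply/funext => x.
  by rewrite mulrDl.
- by have := nodepZ c (IH1 nY); congr nodep; apply/funext => x; rewrite mulrA.
elim: nY => [s' B' ws' mB'|X1 X2 _ IH1 _ IH2|c X1 _ IH1]; last 2 first.
- have := nodepD IH1 IH2; congr nodep; apply/funext => x.
  by rewrite mulrDr.
- by have := nodepZ c IH1; congr nodep; apply/funext => x; rewrite mulrCA.
(* The product of two cylinder indicators is the indicator of the joint cylinder; a word missing
   from one list gets the trivial condition there. *)
pose C v := (if v \in s then B v else setT) `&` (if v \in s' then B' v else setT).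
have mC v : measurable (C v) by apply: measurableI; case: ifP.
have := @nodep_cylinder w (s ++ s') C _ mC.
rewrite mem_cat negb_or ws ws' => /(_ isT); congr nodep.
rewrite -[RHS]indicI; congr indic; apply/seteqP; split => x.
  move=> Cx; split=> v /= vs; have := Cx v; rewrite /= mem_cat vs ?orbT /C => /(_ isT) [].
    by rewrite vs.
  by rewrite vs.
by move=> [Bx B'x] v /= _; split; case: ifP => // vs; [exact: Bx|exact: B'x].
Qed.

(** By linearity it is enough to treat cylinders, where the event on [U w] is one more factor in the
    product formula. *)
Lemma nodep_indep w Z (B : set R) : nodep w Z -> measurable B ->
  Ex (fun x => Z x * \1_B (U w x)) = Ex Z * Pr (U w @^-1` B).
Proof.
move=> nZ mB; have bB : bmf (fun x => \1_B (U w x) : R).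
  exact: bmf_label.
elim: nZ => [s C ws mC|X Y nX IHX nY IHY|c X nX IHX]; last 2 first.
- under [in LHS]eq_fun do rewrite mulrDl.
  have [bX bY] := (nodep_bmf nX, nodep_bmf nY).
  by rewrite (ExD P (bmfM bX bB) (bmfM bY bB)) (ExD P bX bY) mulrDl IHX IHY.
- under [in LHS]eq_fun do rewrite -mulrA.
  have bX := nodep_bmf nX.
  by rewrite (ExZ P c (bmfM bX bB)) (ExZ P c bX) -mulrA IHX.
rewrite Ex_indic; last exact: measurable_cylinder.
pose C' v := if v == w then B else C v.
have mC' v : measurable (C' v) by rewrite /C'; case: ifP.
(* The product formula is assumed only for lists without repetitions. *)
have cs_undup (D : word -> set R) : cylinder s D = cylinder (undup s) D.
  apply/seteqP; split => x sx v /=; first by rewrite mem_undup; exact: sx.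
  by move=> vs; apply: sx; rewrite /= mem_undup.
have -> : (fun x => \1_(cylinder s C) x * \1_B (U w x)) =
    \1_(cylinder (w :: undup s) C') :> (T -> R).
  rewrite cs_undup; apply/funext => x; rewrite !indicE -natrM mulnb.
  congr (nat_of_bool _)%:R; apply/idP/idP; rewrite ?inE.
    move=> /andP[+ +]; rewrite !inE => Cx Bx v /=; rewrite inE /C'.
    by case: eqVneq => [->//|vw] /= vs; exact: Cx.
  move=> Cx; apply/andP; split; apply/mem_set.
    move=> v vs; have := Cx v; rewrite /= inE vs orbT /C' => /(_ isT).
    by case: eqVneq => // vw; move: vs ws; rewrite vw /= mem_undup => ->.
  by have := Cx w; rewrite /= inE eqxx /C' => /(_ isT); rewrite eqxx.
rewrite Ex_indic; last exact: measurable_cylinder.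
have [_ [_ UI]] := UP.
rewrite /Pr cs_undup [in LHS]/cylinder UI //; last first.
  by rewrite /= undup_uniq mem_undup ws.
rewrite [in RHS]/cylinder UI ?undup_uniq // big_cons {1}/C' eqxx mulrC fineM; last 2 first.
- exact: fin_num_measure (measurable_label _ _).
- by apply: prode_fin_num => v _; exact: fin_num_measure (measurable_label _ _).
congr (_ * fine _); apply: eq_big_seq => v; rewrite mem_undup => vs.
by rewrite /C'; case: eqVneq => // vw; rewrite vw (negPf ws) in vs.
Qed.

Lemma Pr_label_lt w (a : R) : 0 <= a <= 1 -> Pr (U w @^-1` [set y | y < a]) = a.
Proof.
move=> /andP[a0 a1]; have [_ [UL _]] := UP.
have mB : measurable [set y : R | y < a].
  by rewrite (_ : [set _ | _] = `]-oo, a[%classic) //; apply/seteqP; split => y /=; rewrite in_itv.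
rewrite /Pr UL // (_ : _ `&` _ = `[0, a[%classic); last first.
  apply/seteqP; split => y /=; rewrite !in_itv /=.
    by move=> [ya /andP[y0 y1]]; rewrite y0.
  by move=> /andP[y0 ya]; split => //; rewrite y0 /= (le_trans (ltW ya)).
rewrite lebesgue_measure_itv /= lte_fin; case: ifP => [_|/negbT]; first by rewrite sube0.
by rewrite -leNgt => a0'; apply/eqP; rewrite eq_le a0 a0'.
Qed.

Lemma Pr_label_close w (a e : R) : 0 <= e ->
  Pr (U w @^-1` [set y : R | (`|y - a| <= e)%R]) <= 2 * e.
Proof.
move=> e0; have [_ [UL _]] := UP.
have E : [set y : R | (`|y - a| <= e)%R] = `[a - e, a + e]%classic.
  by apply/seteqP; split => y /=; rewrite in_itv /= ler_distl.
have le_e : (P (U w @^-1` [set y : R | (`|y - a| <= e)%R]) <= (2 * e)%:E)%E.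
  rewrite UL E //; apply: (@le_trans _ _ (lebesgue_measure `[a - e, a + e]%classic)).
    by apply: le_measure; rewrite ?inE //; exact: measurableI.
  rewrite lebesgue_measure_itv /= lte_fin; case: ifP => _; rewrite lee_fin; last lra.
  by rewrite opprB; lra.
rewrite /Pr -lee_fin fineK // fin_num_measure //; apply: measurable_label.
by rewrite E.
Qed.

(** The bound [i.+1 < n] is essential: the cap in [piv] makes [piv n y <= n] true for every [y]. *)
Lemma piv_leS n i (y : R) : (i.+1 < n)%N ->
  (piv n y <= i.+1)%N = (y < i.+1%:R / n%:R).
Proof.
move=> ni; rewrite /piv geq_min leqNgt ni /= ltnS truncn_le_nat.
by rewrite ltr_pdivlMr ?ltr0n 1?mulrC //; lia.
Qed.

Lemma measurable_piv_le n i : measurable [set y : R | (piv n y <= i)%N].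
Proof.
have [ni|ni] := leqP n i.
  rewrite (_ : [set _ | _] = setT) //; apply/seteqP; split => y //= _.
  by rewrite (leq_trans (piv_le _ _)).
case: i ni => [|i] ni.
  rewrite (_ : [set _ | _] = set0) //; apply/seteqP; split => y //=.
  by have := piv_gt0 y ni; lia.
rewrite (_ : [set _ | _] = `]-oo, i.+1%:R / n%:R[%classic) //.
by apply/seteqP; split => y /=; rewrite in_itv /= piv_leS.
Qed.

Lemma measurable_piv_eq n i : measurable [set y : R | piv n y = i].
Proof.
case: i => [|i].
  rewrite (_ : [set _ | _] = [set y : R | (piv n y <= 0)%N]); first exact: measurable_piv_le.
  by apply/seteqP; split => y /= h; lia.
rewrite (_ : [set _ | _] = [set y : R | (piv n y <= i.+1)%N] `\` [set y : R | (piv n y <= i)%N]).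
  by apply: measurableD; exact: measurable_piv_le.
by apply/seteqP; split => y /=; [move=> ->; split => //; lia|move=> [h1 h2]; lia].
Qed.

Lemma Pr_piv w n i : (0 < n)%N -> (0 < i <= n)%N ->
  Pr (U w @^-1` [set y | piv n y = i]) = n%:R^-1.
Proof.
move=> n0 /andP[i0 ni].
(* Distribution function of the pivot rank; the point mass is a difference of two consecutive
   values. *)
have F j : (j <= n)%N -> Pr (U w @^-1` [set y | (piv n y <= j)%N]) = j%:R / n%:R.
  rewrite leq_eqVlt => /predU1P[->|jn].
    rewrite divff ?pnatr_eq0 -?lt0n // (_ : _ @^-1` _ = setT) /Pr ?probability_setT //.
    by apply/seteqP; split => x //= _; exact: piv_le.
  case: j jn => [|j] jn.
    rewrite mul0r (_ : _ @^-1` _ = set0) /Pr ?measure0 //.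
    by apply/seteqP; split => x //=; have := piv_gt0 (U w x) n0; lia.
  rewrite -(@Pr_label_lt w (j.+1%:R / n%:R)); last first.
    by rewrite divr_ge0 //= ler_pdivrMr ?ltr0n // mul1r ler_nat ltnW.
  by congr (Pr (_ @^-1` _)); apply/seteqP; split => y /=; rewrite piv_leS.
case: i i0 ni => // i _ ni.
have -> : U w @^-1` [set y | piv n y = i.+1] =
   (U w @^-1` [set y | (piv n y <= i.+1)%N]) `\` (U w @^-1` [set y | (piv n y <= i)%N]).
  by apply/seteqP; split => y /=; [move=> ->; split => //; lia|move=> [h1 h2]; lia].
rewrite /Pr measureD; [|by apply: measurable_label; exact: measurable_piv_le..|]; last first.
  rewrite (le_lt_trans (probability_le1 _ _)) ?ltry //.
  by apply: measurable_label; exact: measurable_piv_le.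
rewrite (_ : _ `&` _ = U w @^-1` [set y | (piv n y <= i)%N]); last first.
  by apply/seteqP; split => y /=; [case|move=> h; split => //; lia].
rewrite fineB; [|by apply: fin_num_measure; apply: measurable_label; exact: measurable_piv_le..].
rewrite -!/(Pr _) !F //; last exact: ltnW.
by rewrite -mulrBl -natrB // subSnn mul1r.
Qed.

End Independence.

(** * Conditioning on states, orthogonality of tolls, decay of squared lengths *)

Section SecondMoment.
Context d (T : measurableType d) (R : realType) (P : probability T R).
Variable U : word -> T -> R.
Hypothesis UP : iid_uniform P U.
Implicit Types (X Y Z : T -> R) (w v : word) (s : dstate).
Local Notation Ex := (Ex P).
Local Notation Pr := (Pr P).

Definition dst s w (x : T) : dstate := run (@dstep R) (fun v => U v x) s w.

Lemma dst_rcons s w b x :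
  dst s (rcons w b) x = dsplit (piv (dst s w x).1.1 (U w x)) b (dst s w x).
Proof. exact: run_rcons. Qed.

(** Finitely many values turn conditioning on a state into a finite sum of indicators, with no
    conditional expectation in general. *)
Lemma dst_finite s w : exists2 L : seq dstate, uniq L & forall x, dst s w x \in L.
Proof.
elim/last_ind: w => [|w b [L _ HL]].
  by exists [:: s] => // x; rewrite inE.
exists (undup [seq dsplit i b s' | s' <- L, i <- iota 0 s'.1.1.+1]).
  exact: undup_uniq.
move=> x; rewrite dst_rcons mem_undup; apply/allpairsPdep.
exists (dst s w x), (piv (dst s w x).1.1 (U w x)); split => //.
by rewrite mem_iota ltnS piv_le.
Qed.

Lemma sum_pred1 (L : seq dstate) (s : dstate) (F : dstate -> R) :
  uniq L -> s \in L -> \sum_(s' <- L) (s == s')%:R * F s' = F s.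
Proof.
move=> uL sL; rewrite (bigD1_seq s) //= eqxx mul1r big1 ?addr0 // => s' /negPf.
by rewrite eq_sym => ->; rewrite mul0r.
Qed.

Lemma sum_indic_piv (n N : nat) (y : R) (F : nat -> R) : (n <= N)%N ->
  \sum_(i < N.+1) F i * \1_[set z : R | piv n z = i] y = F (piv n y).
Proof.
move=> nN; have pN : (piv n y < N.+1)%N by rewrite ltnS (leq_trans (piv_le _ _)).
rewrite (bigD1 (Ordinal pN)) //= indicE mem_set // mulr1 big1 ?addr0 // => i iN.
rewrite indicE memNset ?mulr0 //= => E; move: iN; rewrite -val_eqE /= -E.
by rewrite eqxx.
Qed.

(** The state of [w] is determined by the labels of its strict prefixes. Expanding the last step
    over the finitely many previous states and pivot ranks writes its indicator as a sum of products
    in [nodep]. *)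
Lemma nodep_dst v s w : ~~ (prefix v w && (v != w)) ->
  forall s', nodep U v (fun x => (dst s w x == s')%:R).
Proof.
elim/last_ind: w => [|w b IH] nv s'.
  by rewrite [X in nodep _ _ X](_ : _ = cst (s == s')%:R) //; exact: nodep_cst.
have vw : v != w.
  apply: contra nv => /eqP ->; rewrite prefix_rcons /=.
  by apply/eqP => /(congr1 size); rewrite size_rcons; lia.
have nv' : ~~ (prefix v w && (v != w)).
  apply: contra nv => /andP[pvw _]; rewrite (prefix_trans pvw (prefix_rcons _ _)) /=.
  apply/eqP => E; have := size_prefix pvw; rewrite E size_rcons; lia.
have [L uL HL] := dst_finite s w.
rewrite [X in nodep _ _ X](_ : _ = fun x => \sum_(t <- L) (dst s w x == t)%:R *
   \sum_(i < t.1.1.+1) (dsplit i b t == s')%:R * \1_[set z : R | piv t.1.1 z = i] (U w x)).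
  apply: nodep_sum => t; apply: nodepM; first exact: IH.
  apply: nodep_sum => i; apply: nodepZ; apply: nodep_label => //.
  exact: measurable_piv_eq.
apply/funext => x.
rewrite (sum_pred1 (fun t => \sum_(i < t.1.1.+1) (dsplit i b t == s')%:R * _) uL (HL x)).
by rewrite (sum_indic_piv (U w x) (fun i => (dsplit i b _ == s')%:R)) // dst_rcons.
Qed.

Lemma nodep_dst_fun v s w (F : dstate -> R) : ~~ (prefix v w && (v != w)) ->
  nodep U v (fun x => F (dst s w x)).
Proof.
move=> nv; have [L uL HL] := dst_finite s w.
rewrite [X in nodep _ _ X](_ : _ = fun x => \sum_(t <- L) F t * (dst s w x == t)%:R).
  by apply: nodep_sum => t; apply: nodepZ; exact: nodep_dst.
apply/funext => x; rewrite -[LHS](sum_pred1 _ uL (HL x)).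
by apply: eq_bigr => t _; rewrite mulrC.
Qed.

Lemma nodep_dst_piv v s w (F : dstate -> nat -> R) : ~~ prefix v w ->
  nodep U v (fun x => F (dst s w x) (piv (dst s w x).1.1 (U w x))).
Proof.
move=> nv; have [L uL HL] := dst_finite s w.
have vw : v != w by apply: contra nv => /eqP ->; exact: prefix_refl.
rewrite [X in nodep _ _ X](_ : _ = fun x => \sum_(t <- L) (dst s w x == t)%:R *
   \sum_(i < t.1.1.+1) F t i * \1_[set z : R | piv t.1.1 z = i] (U w x)).
  apply: nodep_sum => t; apply: nodepM; first by apply: nodep_dst; rewrite negb_and nv.
  apply: nodep_sum => i; apply: nodepZ; apply: nodep_label => //.
  exact: measurable_piv_eq.
apply/funext => x.
by rewrite (sum_pred1 (fun t => \sum_(i < t.1.1.+1) F t i * _) uL (HL x)) sum_indic_piv.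
Qed.

Lemma bmf_dst_piv s w (F : dstate -> nat -> R) :
  bmf (fun x => F (dst s w x) (piv (dst s w x).1.1 (U w x))).
Proof.
(* Boundedness follows from [nodep] for any label not involved; the label of a child of [w] is
   one. *)
apply: (@nodep_bmf _ _ _ _ _ UP (rcons w true)); apply: nodep_dst_piv.
by apply/negP => /size_prefix; rewrite size_rcons ltnn.
Qed.

Lemma bmf_dst s w (F : dstate -> R) : bmf (fun x => F (dst s w x)).
Proof. exact: (@bmf_dst_piv s w (fun s _ => F s)). Qed.

(** Freezing of the state: neither [Z] nor the state of [v] involves [U v], so on each value of the
    state the set [B] is fixed and independence applies. *)
Lemma cond_label v Z s (B : dstate -> set R) : nodep U v Z ->
  (forall t, measurable (B t)) ->
  Ex (fun x => Z x * \1_(B (dst s v x)) (U v x)) =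
  Ex (fun x => Z x * Pr (U v @^-1` B (dst s v x))).
Proof.
move=> nZ mB; have [L uL HL] := dst_finite s v.
have nst t : nodep U v (fun x => Z x * (dst s v x == t)%:R).
  by apply: nodepM => //; apply: nodep_dst; rewrite eqxx andbF.
have bst t := nodep_bmf UP (nst t).
transitivity (\sum_(t <- L) Ex (fun x => Z x * (dst s v x == t)%:R * \1_(B t) (U v x))).
  rewrite -Ex_sum; last by move=> t; exact: bmfM (bst t) (bmf_label UP v (mB t)).
  congr Ex; apply/funext => x.
  rewrite -(sum_pred1 (fun t => \1_(B t) (U v x)) uL (HL x)) mulr_sumr.
  by apply: eq_bigr => t _; rewrite mulrA.
transitivity (\sum_(t <- L) Ex (fun x => Pr (U v @^-1` B t) * (Z x * (dst s v x == t)%:R))).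
  by apply: eq_bigr => t _; rewrite nodep_indep // ExZ // mulrC.
rewrite -Ex_sum; last by move=> t; exact: bmfZ.
congr Ex; apply/funext => x.
rewrite -(sum_pred1 (fun t => Pr (U v @^-1` B t)) uL (HL x)) mulr_sumr.
by apply: eq_bigr => t _; rewrite mulrC mulrA.
Qed.

(** For [n = 0] the pivot rank is 0, hence the special value. *)
Definition avg (n : nat) (F : nat -> R) : R :=
  if n == 0%N then F 0%N else (\sum_(1 <= i < n.+1) F i) / n%:R.

Lemma cond_piv v Z s (F : dstate -> nat -> R) : nodep U v Z ->
  Ex (fun x => Z x * F (dst s v x) (piv (dst s v x).1.1 (U v x))) =
  Ex (fun x => Z x * avg (dst s v x).1.1 (F (dst s v x))).
Proof.
move=> nZ; have [L uL HL] := dst_finite s v.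
pose N := (\max_(t <- L) t.1.1)%N.
have LN x : ((dst s v x).1.1 <= N)%N by exact: leq_bigmax_seq.
have nF i : nodep U v (fun x => Z x * F (dst s v x) i).
  by apply: nodepM => //; apply: (nodep_dst_fun s (fun t => F t i)); rewrite eqxx andbF.
pose B i (t : dstate) := [set z : R | piv t.1.1 z = i].
have mB i t : measurable (B i t) by exact: measurable_piv_eq.
have bB i : bmf (fun x => Z x * F (dst s v x) i * \1_(B i (dst s v x)) (U v x)).
  apply: (bmfM (nodep_bmf UP (nF i))).
  rewrite [X in bmf X](_ : _ = fun x =>
      (fun _ j => (j == i)%:R) (dst s v x) (piv (dst s v x).1.1 (U v x))).
    exact: (bmf_dst_piv s v (fun _ j => (j == i)%:R)).
  apply/funext => x; rewrite indicE; congr (nat_of_bool _)%:R.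
  by apply/idP/eqP; rewrite ?inE.
have bP i : bmf (fun x => Z x * F (dst s v x) i * Pr (U v @^-1` B i (dst s v x))).
  apply: (bmfM (nodep_bmf UP (nF i))).
  exact: (bmf_dst s v (fun t => Pr (U v @^-1` B i t))).
transitivity (\sum_(i < N.+1) Ex (fun x => Z x * F (dst s v x) i * \1_(B i (dst s v x)) (U v x))).
  rewrite -Ex_sum //; congr Ex; apply/funext => x.
  rewrite -(sum_indic_piv _ (F (dst s v x)) (LN x)) mulr_sumr.
  by apply: eq_bigr => i _; rewrite mulrA.
under eq_bigr do rewrite cond_label //.
rewrite -Ex_sum //; congr Ex; apply/funext => x.
under eq_bigr do rewrite -mulrA; rewrite -mulr_sumr; congr (_ * _).
have PrT : Pr setT = 1 by rewrite /Pr -[RHS]/(fine 1%E) -(probability_setT P).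
have Pr0 : Pr set0 = 0 by rewrite /Pr measure0.
move: (dst s v x) (LN x) => t tN.
(* Ranks that the pivot never takes: above the length, zero for a nonempty list, nonzero for an
   empty one. *)
have out i : (t.1.1 < i)%N || ((i == 0%N) != (t.1.1 == 0%N)) && (i * t.1.1 == 0)%N ->
    U v @^-1` B i t = set0.
  move=> it; apply/seteqP; split => y // E; move: it; rewrite -E.
  have := piv_le t.1.1 (U v y); have := @piv_gt0 _ t.1.1 (U v y).
  by set q := piv _ _; case: posnP => [->|n0]; nia.
rewrite /avg; case: posnP => [t0|t0].
  rewrite big_ord_recl big1 ?addr0 => [|i _]; last by rewrite out ?Pr0 ?mulr0 // t0 /bump.
  rewrite (_ : U v @^-1` _ = setT) ?PrT ?mulr1 //; apply/seteqP; split => y // _.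
  by change (piv t.1.1 (U v y) = 0%N); apply/eqP; rewrite -leqn0 -[leqRHS]t0 piv_le.
rewrite -(big_mkord xpredT (fun i => F t i * Pr (U v @^-1` B i t))).
rewrite big_ltn // out ?Pr0 ?mulr0 ?add0r; last by rewrite (gtn_eqF t0) mul0n eqxx orbT.
rewrite (big_cat_nat _ (n := t.1.1.+1)) //=.
rewrite [X in _ + X]big_nat_cond [X in _ + X]big1 ?addr0; last first.
  by move=> i /andP[/andP[ti _] _]; rewrite out ?Pr0 ?mulr0 // ti.
rewrite mulr_suml; apply: eq_big_nat => i /andP[i0 it].
by rewrite Pr_piv // i0.
Qed.

(* Given its state, the toll of a node is centred: this makes tolls orthogonal. *)
Lemma avg_dtoll (s : dstate) : (s.1.2 <= s.1.1)%N -> avg s.1.1 (dtoll R s) = 0.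
Proof.
case: s => [[n l] f] /= ln; rewrite /avg /dtoll.
case E: [|| _, _ | _]; first by rewrite big1_eq mul0r if_same.
move/negbT: E; rewrite !negb_or => /and3P[n1 l0 _].
have n0 : (0 < n)%N by lia.
have n0' : n%:R != 0 :> R by rewrite pnatr_eq0; lia.
rewrite gtn_eqF //; apply/eqP; rewrite mulf_eq0 invr_eq0 (negPf n0') orbF; apply/eqP.
rewrite (eq_bigr (fun i => (mean_cmp R i.-1 (minn l i.-1) + mean_cmp R (n - i) (l - i))
    + (n%:R - 1 - mean_cmp R n l))); last by move=> i _; ring.
have ln' : (0 < l <= n)%N by rewrite ln lt0n l0.
rewrite big_split /= (sum_mean_cmp R ln') sumr_const_nat subn1 /= -mulr_natl.
by ring.
Qed.

Lemma dst_le s w x : (s.1.2 <= s.1.1)%N -> ((dst s w x).1.2 <= (dst s w x).1.1)%N.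
Proof.
move=> sl; elim/last_ind: w => [//|w b IH]; rewrite dst_rcons.
case: (dst s w x) IH => [[n l] f] /= ln; set i := piv _ _.
by case: b => /=; [lia|exact: geq_minr].
Qed.

Lemma dst_nle s w x : ((dst s w x).1.1 <= s.1.1)%N.
Proof.
elim/last_ind: w => [//|w b IH]; rewrite dst_rcons; apply: leq_trans IH.
case: (dst s w x) => [[n l] f] /=; have := piv_le n (U w x); set i := piv _ _.
by case: b => /=; lia.
Qed.

Definition dtm s w : T -> R := fun x => dterm (fun v => U v x) s w.

Lemma bmf_dtm s w : bmf (dtm s w).
Proof. exact: bmf_dst_piv. Qed.

(** As [v] is at least as long as [w] and different from it, [v] is no prefix of [w], so the toll of
    [w] does not involve [U v]. Averaging over the pivot of [v] annihilates the product. *)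
Lemma dtm_orthogonal s w v : (s.1.2 <= s.1.1)%N -> w != v -> (size w <= size v)%N ->
  Ex (fun x => dtm s w x * dtm s v x) = 0.
Proof.
move=> sl wv sz.
have nw : ~~ prefix v w.
  apply: contra wv => /prefixP[w' E]; move: sz; rewrite E size_cat.
  by case: w' E => [|a w'] E; rewrite ?cats0 //=; lia.
rewrite [LHS](@cond_piv v (dtm s w) s (dtoll R)); last exact: nodep_dst_piv.
rewrite -[RHS](Ex_cst P 0); congr Ex; apply/funext => x.
by rewrite avg_dtoll ?mulr0 //; exact: dst_le.
Qed.

Lemma dtm_bound s w x : (s.1.2 <= s.1.1)%N ->
  `|dtm s w x| <= 75 * (dst s w x).1.1%:R.
Proof.
move=> sl; rewrite /dtm /dterm; have := dst_le w x sl; rewrite /dst.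
set t := run _ _ _ _ => tl; case: (posnP t.1.1) => [t0|t0].
  case: t tl t0 => [[n l] f] /= _ ->; by rewrite leq0n orTb normr0 mulr0.
by apply: dtoll_bound => //; rewrite piv_gt0 // piv_le.
Qed.

(** Origin of the ratio 2/3: the left side equals [n (n - 1) (2 n - 1) / 3]. *)
Lemma sum_sqr_split n : (0 < n)%N ->
  \sum_(1 <= i < n.+1) ((i.-1)%:R ^+ 2 + (n - i)%:R ^+ 2) <= 2 / 3 * n%:R ^+ 3 :> R.
Proof.
move=> n0; rewrite big_add1 /= big_split /= [X in _ + X]big_nat_rev /=.
rewrite [X in _ + X](_ : _ = \sum_(0 <= i < n) i%:R ^+ 2); last first.
  by apply: eq_big_nat => i /andP[_ ni]; congr (_%:R ^+ 2); lia.
have -> : \sum_(0 <= i < n) i%:R ^+ 2 = n%:R * (n%:R - 1) * (2 * n%:R - 1) / 6 :> R.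
  elim: {n0} n => [|n IH]; first by rewrite big_geq //; ring.
  by rewrite big_nat_recr //= IH -natr1; field.
have : 1 <= n%:R :> R by rewrite ler1n.
move: n%:R => a a1; nra.
Qed.

Lemma Ex_size_split s w :
  Ex (fun x => (dst s (rcons w false) x).1.1%:R ^+ 2 + (dst s (rcons w true) x).1.1%:R ^+ 2)
  <= 2 / 3 * Ex (fun x => (dst s w x).1.1%:R ^+ 2).
Proof.
have b1 := bmf_dst s w (fun t => t.1.1%:R ^+ 2).
rewrite -ExZ //.
have := @cond_piv w _ s (fun t i => (i.-1)%:R ^+ 2 + (t.1.1 - i)%:R ^+ 2)
  (nodep_cst _ w 1).
have -> : (fun x => cst 1 x * (((piv (dst s w x).1.1 (U w x)).-1)%:R ^+ 2 +
      ((dst s w x).1.1 - piv (dst s w x).1.1 (U w x))%:R ^+ 2)) =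
  (fun x => (dst s (rcons w false) x).1.1%:R ^+ 2
    + (dst s (rcons w true) x).1.1%:R ^+ 2) :> (T -> R).
  apply/funext => x; rewrite mul1r !dst_rcons; by case: (dst s w x) => [[n l] f].
move=> ->; apply: Ex_le.
- apply: bmfM; first exact: bmf_cst.
  exact: (bmf_dst s w (fun t => avg t.1.1 (fun i => (i.-1)%:R ^+ 2 + (t.1.1 - i)%:R ^+ 2))).
- exact: bmfZ.
move=> x; rewrite mul1r /avg; case: posnP => [->|n0].
  by rewrite sub0n /= expr0n /= addr0 mulr_ge0.
rewrite ler_pdivrMr ?ltr0n // (le_trans (sum_sqr_split n0)) //.
by rewrite -[leRHS]mulrA -exprSr.
Qed.

Lemma Ex_size_level s j :
  \sum_(w : j.-tuple bool) Ex (fun x => (dst s w x).1.1%:R ^+ 2)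
  <= (2 / 3) ^+ j * s.1.1%:R ^+ 2.
Proof.
elim: j => [|j IH].
  rewrite (big_pred1 [tuple]) => [|w]; last by apply/esym/eqP; exact: tuple0.
  by rewrite mul1r [Ex _](Ex_cst P (s.1.1%:R ^+ 2)).
rewrite exprS -mulrA (le_trans _ (ler_wpM2l _ IH)) //.
rewrite (big_tuple_rcons (fun w => Ex (fun x => (dst s w x).1.1%:R ^+ 2))).
rewrite mulr_sumr -big_split /=; apply: ler_sum => w _.
by rewrite -ExD; [exact: Ex_size_split|exact: (bmf_dst s _ (fun t => t.1.1%:R ^+ 2))..].
Qed.

End SecondMoment.

(** * Geometric bounds for deep tolls, and the mean of X(n,l) *)

Section TailBound.
Context d (T : measurableType d) (R : realType) (P : probability T R).
Variable U : word -> T -> R.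
Hypothesis UP : iid_uniform P U.
Implicit Types (w v : word) (s : dstate).
Local Notation Ex := (Ex P).
Local Notation dtm := (dtm U).
Local Notation dst := (dst U).

(* [75 n] bounds the toll of a list of length [n]; summing its squares over the
   levels gives a geometric series of ratio [2/3]. *)
Definition sqr_const : R := 75 ^+ 2.
Definition tail_const : R := 3 * sqr_const + 1.

Lemma sqr_const_ge0 : 0 <= sqr_const. Proof. exact: exprn_ge0. Qed.

Definition level_sum s j (x : T) : R := \sum_(w : j.-tuple bool) dtm s w x.

Lemma bmf_level_sum s j : bmf (level_sum s j).
Proof. by apply: bmf_sum => w; exact: (bmf_dtm UP). Qed.

Lemma level_sum_orthogonal s i j : (s.1.2 <= s.1.1)%N -> (i < j)%N ->
  Ex (fun x => level_sum s i x * level_sum s j x) = 0.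
Proof.
move=> sl ij; rewrite /level_sum.
under [X in Ex X]eq_fun do rewrite mulr_suml.
have bMv w v : bmf (fun x => dtm s w x * dtm s v x) by apply: bmfM; exact: (bmf_dtm UP).
rewrite [LHS]Ex_sum => [|w]; last first.
  by apply: bmfM; [exact: (bmf_dtm UP)|exact: bmf_level_sum].
rewrite big1 // => w _; under [X in Ex X]eq_fun do rewrite mulr_sumr.
rewrite [LHS]Ex_sum ?big1 // => v _; apply: (dtm_orthogonal UP) => //.
  by apply/eqP => /(congr1 size); rewrite !size_tuple; lia.
by rewrite !size_tuple ltnW.
Qed.

Lemma Ex_level_sum_sqr s j : (s.1.2 <= s.1.1)%N ->
  Ex (fun x => level_sum s j x ^+ 2) <= sqr_const * (2 / 3) ^+ j * s.1.1%:R ^+ 2.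
Proof.
move=> sl; have bMv w v : bmf (fun x => dtm s w x * dtm s v x).
  by apply: bmfM; exact: (bmf_dtm UP).
have -> : Ex (fun x => level_sum s j x ^+ 2) =
    \sum_(w : j.-tuple bool) Ex (fun x => dtm s w x ^+ 2).
  rewrite /level_sum; under [X in Ex X]eq_fun do rewrite expr2 mulr_suml.
  rewrite [LHS]Ex_sum => [|w]; last first.
    by apply: bmfM; [exact: (bmf_dtm UP)|exact: bmf_level_sum].
  apply: eq_bigr => w _; under [X in Ex X]eq_fun do rewrite mulr_sumr.
  rewrite [LHS]Ex_sum // (bigD1 w) //= big1 ?addr0 // => v vw.
  by apply: (dtm_orthogonal UP); rewrite ?size_tuple // eq_sym.
have c0 := sqr_const_ge0.
rewrite -mulrA (le_trans _ (ler_wpM2l c0 (Ex_size_level UP s j))) //.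
rewrite mulr_sumr; apply: ler_sum => w _.
have bs := bmf_dst UP s w (fun t => t.1.1%:R ^+ 2).
rewrite -ExZ //; apply: Ex_le; [exact: bMv|exact: bmfZ|].
move=> x; have := dtm_bound U w x sl; set a := dtm s w x; set b := _%:R => ab.
rewrite -exprMn.
by rewrite -real_normK ?num_real // lerXn2r ?nnegrE // mulr_ge0.
Qed.

Definition tail_sum s m M (x : T) : R := \sum_(m <= j < M) level_sum s j x.

Lemma bmf_tail_sum s m M : bmf (tail_sum s m M).
Proof. by apply: bmf_sum => j; exact: bmf_level_sum. Qed.

Lemma Ex_tail_sum_sqr s m M : (s.1.2 <= s.1.1)%N ->
  Ex (fun x => tail_sum s m M x ^+ 2) <= (3 * sqr_const) * (2 / 3) ^+ m * s.1.1%:R ^+ 2.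
Proof.
move=> sl; have c0 := sqr_const_ge0; have c3 : 0 <= 3 * sqr_const by rewrite mulr_ge0.
have [mM|Mm] := leqP m M; last first.
  under [X in Ex X]eq_fun do rewrite /tail_sum big_geq ?(ltnW Mm) // expr0n.
  by rewrite Ex_cst !mulr_ge0 // exprn_ge0 // divr_ge0.
(* Strengthened for induction on [M]: [3 * ((2/3)^M - (2/3)^(M+1)) = (2/3)^M] is exactly the room
   required by the next level. *)
suff H : Ex (fun x => tail_sum s m M x ^+ 2) <=
    (3 * sqr_const) * ((2 / 3) ^+ m - (2 / 3) ^+ M) * s.1.1%:R ^+ 2.
  rewrite (le_trans H) // ler_wpM2r ?exprn_ge0 // ler_wpM2l //.
  by rewrite lerBlDr lerDl exprn_ge0.
elim: M mM => [|M IH]; rewrite ?leqn0 => mM.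
  rewrite (eqP mM) subrr mulr0 mul0r.
  under [X in Ex X]eq_fun do rewrite /tail_sum big_geq // expr0n.
  by rewrite Ex_cst.
move: mM; rewrite leq_eqVlt => /predU1P[->|mM].
  rewrite subrr mulr0 mul0r.
  under [X in Ex X]eq_fun do rewrite /tail_sum big_geq // expr0n.
  by rewrite Ex_cst.
have b1 := bmf_tail_sum s m M; have b2 := bmf_level_sum s M.
have E0 : Ex (fun x => tail_sum s m M x * level_sum s M x) = 0.
  rewrite /tail_sum; under [X in Ex X]eq_fun do rewrite mulr_suml.
  rewrite Ex_sum => [|j]; last by apply: bmfM => //; exact: bmf_level_sum.
  by apply: big1_seq => j; rewrite mem_index_iota => /andP[_ /andP[_ jM]];
     exact: level_sum_orthogonal.
have -> : (fun x => tail_sum s m M.+1 x ^+ 2) = (fun x => tail_sum s m M x ^+ 2 +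
   (2 * (tail_sum s m M x * level_sum s M x) + level_sum s M x ^+ 2)).
  by apply/funext => x; rewrite /tail_sum big_nat_recr //=; ring.
have b3 := bmfM b1 b2; have b4 := bmfM b2 b2; have b5 := bmfM b1 b1.
rewrite ExD; [|exact: b5|by apply: bmfD; [exact: bmfZ|exact: b4]].
rewrite ExD; [|exact: bmfZ|exact: b4].
rewrite ExZ // E0 mulr0 add0r (le_trans (lerD (IH mM) (Ex_level_sum_sqr M sl))) //.
rewrite (exprS _ M).
by move: ((2 / 3) ^+ m : R) ((2 / 3) ^+ M : R) (s.1.1%:R ^+ 2 : R) sqr_const => a b c e; lra.
Qed.

(** Takes the place of the Cauchy-Schwarz inequality: with [e] of the order of the standard
    deviation it converts a second moment bound into a first moment bound. *)
Lemma norm_le_sqr (a e : R) : 0 < e -> `|a| <= a ^+ 2 / e + e.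
Proof.
move=> e0; rewrite -(ler_pM2r e0) mulrDl divfK ?gt_eqF // -real_normK ?num_real //.
by have := normr_ge0 a; move: `|a| => b b0; nra.
Qed.

Lemma Ex_tail_sum s m M : (s.1.2 <= s.1.1)%N ->
  Ex (fun x => `|tail_sum s m M x|) <= tail_const * (5 / 6) ^+ m * s.1.1%:R.
Proof.
move=> sl; have b1 := bmf_tail_sum s m M.
have c3 : 0 <= 3 * sqr_const by rewrite mulr_ge0 // sqr_const_ge0.
have [s0|s0] := posnP s.1.1.
  have -> : (fun x => `|tail_sum s m M x|) = cst 0.
    apply/funext => x; rewrite /tail_sum big1 ?normr0 // => j _.
    rewrite /level_sum big1 // => w _; apply/eqP; rewrite -normr_le0.
    rewrite (le_trans (dtm_bound U w x sl)) //.
    by have := dst_nle U s w x; rewrite s0 leqn0 => /eqP ->; rewrite mulr0.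
  by rewrite Ex_cst s0 mulr0.
(* The value of [e]. As 25/36 exceeds 2/3, the second moment divided by [e] is at most
   [3 * sqr_const * e]; adding [e] itself explains [tail_const]. *)
have e0 : 0 < (5 / 6) ^+ m * s.1.1%:R :> R by rewrite mulr_gt0 ?ltr0n // exprn_gt0.
have b2 := bmfM b1 b1.
rewrite (@le_trans _ _ (Ex (fun x => ((5 / 6) ^+ m * s.1.1%:R)^-1 * tail_sum s m M x ^+ 2
   + cst ((5 / 6) ^+ m * s.1.1%:R) x))) //.
  apply: Ex_le; [exact: bmf_abs| |].
    by apply: bmfD; [exact: bmfZ|exact: bmf_cst].
  by move=> x; rewrite mulrC; exact: norm_le_sqr.
rewrite ExD; [|exact: bmfZ|exact: bmf_cst].
rewrite ExZ // Ex_cst.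
have -> : tail_const * (5 / 6) ^+ m * s.1.1%:R = (3 * sqr_const) * ((5 / 6) ^+ m * s.1.1%:R)
  + (5 / 6) ^+ m * s.1.1%:R :> R by rewrite /tail_const; ring.
rewrite lerD2r mulrC ler_pdivrMr // (le_trans (Ex_tail_sum_sqr m M sl)) //.
have -> : (3 * sqr_const) * ((5 / 6) ^+ m * s.1.1%:R) * ((5 / 6) ^+ m * s.1.1%:R) =
  (3 * sqr_const) * (25 / 36) ^+ m * s.1.1%:R ^+ 2 :> R.
  have -> : 25 / 36 = 5 / 6 * (5 / 6) :> R by field.
  by move: (5 / 6 : R) => a; rewrite exprMn; move: (a ^+ m) => b; ring.
rewrite ler_wpM2r ?exprn_ge0 // ler_wpM2l // lerXn2r ?nnegrE //; lra.
Qed.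

Lemma sumVlt_tail s m M x : (m <= M)%N ->
  sumVlt M (fun w => dtm s w x) = sumVlt m (fun w => dtm s w x) + tail_sum s m M x.
Proof.
move=> mM; rewrite /sumVlt /tail_sum -2!(big_mkord xpredT (fun j => level_sum s j x)).
by rewrite (big_cat_nat _ (n := m)).
Qed.

Lemma bmf_sumVlt_dtm s m : bmf (fun x => sumVlt m (fun w => dtm s w x)).
Proof. by apply: bmf_sum => j; exact: bmf_level_sum. Qed.

Lemma sumVlt_dtm_bound s m x : (s.1.2 <= s.1.1)%N ->
  `|sumVlt m (fun w => dtm s w x)| <= sumVlt m (fun=> 75) * s.1.1%:R.
Proof.
move=> sl; rewrite mulr_suml (le_trans (ler_norm_sum _ _ _)) //; apply: ler_sum => j _.
rewrite mulr_suml (le_trans (ler_norm_sum _ _ _)) //; apply: ler_sum => w _.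
by rewrite (le_trans (dtm_bound U w x sl)) // ler_wpM2l // ler_nat dst_nle.
Qed.

Lemma Ex_dtm s w : (s.1.2 <= s.1.1)%N -> Ex (dtm s w) = 0.
Proof.
move=> sl; have := @cond_piv _ _ _ _ _ UP w _ s (dtoll R) (nodep_cst U w 1).
under [X in Ex X = _]eq_fun do rewrite mul1r.
move=> ->; rewrite -[RHS](Ex_cst P 0); congr Ex; apply/funext => x.
by rewrite avg_dtoll ?mulr0 //; exact: dst_le.
Qed.

(** Only here does the closed form become the expectation: the tolls are centred and the expansion
    starts from [mean_cmp R n l]. *)
Lemma Ex_Xq n l : (l <= n)%N -> Ex (fun x => (Xq (fun v => U v x) n l)%:R) = mean_cmp R n l.
Proof.
move=> ln; under [X in Ex X]eq_fun do rewrite (@Xq_tolls _ _ _ _ n) ?ln ?leqnn //.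
rewrite (@ExD _ _ _ P (cst (mean_cmp R n l)) (fun x => sumVlt n (fun w => dtm (n, l, None) w x)));
  [|exact: bmf_cst|exact: bmf_sumVlt_dtm].
rewrite Ex_cst Ex_sum => [|j]; last exact: bmf_level_sum.
rewrite big1 ?addr0 // => j _; rewrite Ex_sum => [|w]; last exact: (bmf_dtm UP).
by rewrite big1 // => w _; exact: Ex_dtm.
Qed.

Definition start (t : R) (n : nat) (f : option nat) : dstate :=
  (n, Num.truncn (n%:R * t), f).

Lemma start_le t n f : 0 <= t <= 1 -> ((start t n f).1.2 <= (start t n f).1.1)%N.
Proof.
move=> /andP[t0 t1] /=; rewrite -[leqRHS](@natrK R n).
by apply: le_truncn; rewrite ler_piMr.
Qed.

Lemma Yn_tolls n M t x : 0 <= t <= 1 -> (n <= M)%N ->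
  Yn P U n t x = sumVlt M (fun w => dtm (start t n None) w x) / n%:R.
Proof.
move=> t01 nM; have ln := start_le n None t01.
rewrite /Yn unlock -[fine _]/(Ex _) Ex_Xq // (@Xq_tolls _ _ _ _ M) ?nM ?andbT //.
by rewrite addrC addKr.
Qed.

Lemma Ex_Yn_tail n m t : 0 <= t <= 1 -> (0 < n)%N ->
  Ex (fun x => `|Yn P U n t x - sumVlt m (fun w => dtm (start t n None) w x) / n%:R|)
  <= tail_const * (5 / 6) ^+ m.
Proof.
move=> t01 n0.
have -> : (fun x => `|Yn P U n t x - sumVlt m (fun w => dtm (start t n None) w x) / n%:R|)
  (* The depth [maxn n m] is large enough both for the exact expansion of [Yn] and for splitting off
     the first [m] levels. *)
  = (fun x => n%:R^-1 * `|tail_sum (start t n None) m (maxn n m) x|).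
  apply/funext => x; rewrite (Yn_tolls x t01 (leq_maxl n m)) -mulrBl mulrC normrM.
  rewrite ger0_norm ?invr_ge0 // (sumVlt_tail _ _ (leq_maxr n m)).
  by rewrite addrC addKr.
rewrite ExZ; last by apply: bmf_abs; exact: bmf_tail_sum.
rewrite mulrC ler_pdivrMr ?ltr0n //.
by apply: (le_trans (Ex_tail_sum _ _ _)) => //; exact: start_le.
Qed.

Lemma bmf_Yn n t : 0 <= t <= 1 -> bmf (Yn P U n t).
Proof.
move=> t01; rewrite [X in bmf X](_ : _ = fun x =>
  n%:R^-1 * sumVlt n (fun w => dtm (start t n None) w x)).
  by apply: bmfZ; exact: bmf_sumVlt_dtm.
by apply/funext => x; rewrite (Yn_tolls x t01 (leqnn n)) mulrC.
Qed.

End TailBound.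

(** * Convergence of the normalized tolls *)

Section HarmonicAsymptotics.
Variable R : realType.
Implicit Types (f g x z : nat -> R) (k : nat -> nat).

Lemma cvg_near_eq f g (l l' : R) : (\forall n \near \oo, f n = g n) -> l = l' ->
  f n @[n --> \oo] --> l -> g n @[n --> \oo] --> l'.
Proof. by move=> fg <- fl; apply: cvg_trans fl; exact: near_eq_cvg. Qed.

Lemma cvg_natV : (n%:R^-1 : R) @[n --> \oo] --> (0 : R).
Proof.
have := @cvg_harmonic R; rewrite -(cvg_shiftS (fun n : nat => n%:R^-1 : R)); exact.
Qed.

Lemma cvg_div_close x z (l : R) : (forall n, `|x n - z n| <= 1) ->
  z n / n%:R @[n --> \oo] --> l -> x n / n%:R @[n --> \oo] --> l.
Proof.
move=> xz zl.
have h : (x n - z n) / n%:R @[n --> \oo] --> (0 : R).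
  apply: norm_cvg0; apply: (@squeeze_cvgr _ _ _ _ (cst 0) (fun n => n%:R^-1)).
  - near=> n; rewrite normr_ge0 normrM [`|n%:R^-1|]ger0_norm ?invr_ge0 //.
    by rewrite ler_piMl // invr_ge0.
  - exact: cvg_cst.
  - exact: cvg_natV.
apply: cvg_near_eq (cvgD h zl); last by rewrite add0r.
by near=> n => /=; rewrite mulrBl subrK.
Unshelve. all: by end_near. Qed.

Lemma cvg_nat_near_gt k (c : R) (j : nat) : 0 < c ->
  (k n)%:R / n%:R @[n --> \oo] --> c -> \forall n \near \oo, (j < k n)%N.
Proof.
move=> c0 kc.
have jc : j%:R / n%:R @[n --> \oo] --> (0 : R).
  by rewrite -(mulr0 j%:R); apply: cvgM; [exact: cvg_cst|exact: cvg_natV].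
have c2 : 0 < c / 2 by rewrite divr_gt0.
near=> n.
have n0 : (0 < n)%N by near: n; exact: nbhs_infty_gt.
have h1 : c / 2 < (k n)%:R / n%:R by near: n; apply: (cvgr_gt _ kc); lra.
have h2 : j%:R / n%:R < c / 2 by near: n; apply: (cvgr_lt _ jc).
have := lt_trans h2 h1; rewrite ltr_pM2r ?ltr_nat // invr_gt0 ltr0n //.
Unshelve. all: by end_near. Qed.

(** [1 / (n+1)] lies between [ln ((n+2)/(n+1))] and [ln ((n+1)/n)]. Only differences of harmonic
    numbers occur, so Euler's constant never enters. *)
Lemma harm_ln_bounds (k n : nat) : (0 < k <= n)%N ->
  ln n.+1%:R - ln k.+1%:R <= harm R n - harm R k <= ln n%:R - ln k%:R.
Proof.
move=> /andP[k0]; elim: n => [|n IH]; first by rewrite leqn0 => /eqP E; rewrite E in k0.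
rewrite leq_eqVlt ltnS => /predU1P[->|kn]; first by rewrite !subrr lexx.
have /andP[h1 h2] := IH kn; have n0 : (0 < n)%N by lia.
rewrite harmS.
have p1 : 0 < n%:R :> R by rewrite ltr0n.
have p2 : 0 < n.+1%:R :> R by rewrite ltr0n.
have p3 : 0 < n.+2%:R :> R by rewrite ltr0n.
have e1 : ln n.+2%:R - ln n.+1%:R <= n.+1%:R^-1 :> R.
  rewrite -ln_div ?posrE // -[n.+2%:R]natr1 mulrDl divff ?gt_eqF // mul1r.
  by apply: le_ln1Dx; rewrite (lt_trans _ (_ : 0 < _)) // invr_gt0.
have e2 : n.+1%:R^-1 <= ln n.+1%:R - ln n%:R :> R.
  rewrite -[leRHS]opprB -ln_div ?posrE // lerNr.
  have -> : n%:R / n.+1%:R = 1 + (- n.+1%:R^-1) :> R.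
    by rewrite -natr1; field; rewrite natr1 gt_eqF.
  apply: le_ln1Dx; rewrite ltrN2 invf_lt1 // ltr1n; lia.
move: (n.+1%:R^-1 : R) (ln n.+2%:R : R) (ln n.+1%:R : R) (ln n%:R : R) e1 e2 h1 h2.
by move=> x lb la ln e1 e2 h1 h2; apply/andP; split; lra.
Qed.

Lemma cvg_harm_ln k (c : R) : 0 < c -> (forall n, (k n <= n)%N) ->
  (k n)%:R / n%:R @[n --> \oo] --> c ->
  harm R (k n) - harm R n @[n --> \oo] --> ln c.
Proof.
move=> c0 kn kc.
have cl := continuous_ln c0.
have kc' : (k n).+1%:R / n.+1%:R @[n --> \oo] --> c.
  have h1 : (1 + n%:R^-1 : R) @[n --> \oo] --> (1 + 0 : R).
    by apply: cvgD; [exact: cvg_cst|exact: cvg_natV].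
  rewrite addr0 in h1.
  have h2 : (1 + n%:R^-1 : R)^-1 @[n --> \oo] --> (1^-1 : R).
    by apply: cvgV => //; exact: oner_neq0.
  apply: cvg_near_eq (cvgM (cvgD kc cvg_natV) h2); last by rewrite addr0 invr1 mulr1.
  near=> n => /=; have n0 : (0 < n)%N by near: n; exact: nbhs_infty_gt.
  rewrite -!natr1; have n0' : 0 < n%:R :> R by rewrite ltr0n.
  by rewrite ?fctE /=; field; rewrite !gt_eqF // ?addr_gt0.
apply: (@squeeze_cvgr _ _ _ _ (fun n => ln ((k n)%:R / n%:R))
  (fun n => ln ((k n).+1%:R / n.+1%:R))).
- near=> n.
  have k0 : (0 < k n)%N by near: n; exact: cvg_nat_near_gt kc.
  have := @harm_ln_bounds (k n) n; rewrite k0 kn => /(_ isT).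
  have n0 : (0 < n)%N by rewrite (leq_trans k0).
  by rewrite !ln_div ?posrE ?ltr0n //; lra.
- exact: cvg_comp kc cl.
- exact: cvg_comp kc' cl.
Unshelve. all: by end_near. Qed.

End HarmonicAsymptotics.

(** * Limits of normalized states and tolls along a path *)

Section LimitStates.
Variable R : realType.
Implicit Types (u : word -> R) (y : R).

(* Limit of [dstate]: lengths and ranks are divided by the length of the
   initial list, so that a rank [l] out of [n] has relative position [s / ell]. *)
Definition cstate := (R * R * option nat)%type.

Definition csplit (p : R) (b : bool) (c : cstate) : cstate :=
  let: (l, s, f) := c in
  if b then (l - p, Num.max 0 (s - p), dec_flag f)
  else (p, Num.min s p, if s < p then dec_flag f else full_flag f).

Definition cstep y (b : bool) (c : cstate) : cstate := csplit (c.1.1 * y) b c.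

(** The guard [0 < s] mirrors X(n,0) = 0; without it the term would be wrong, since
    [Ctx 0 y = 2 y - 1] for [y] in (0,1]. *)
Definition ctoll (c : cstate) y : R :=
  let: (l, s, f) := c in if (0 < s) && live f then l * Ctx (s / l) y else 0.

Definition cterm u (c : cstate) w : R := ctoll (run cstep u c w) (u w).

Definition good_label (c : cstate) y := 0 < c.1.2 -> c.1.2 != c.1.1 * y.

(** Tolls jump at rank zero, hence the fourth clause: a zero limit rank must be attained exactly.
    Flags are compared only when the limit rank is positive, as other nodes contribute nothing. *)
Definition state_cvg (a : nat -> dstate) (c : cstate) :=
  [/\ (a n).1.1%:R / n%:R @[n --> \oo] --> c.1.1,
      (a n).1.2%:R / n%:R @[n --> \oo] --> c.1.2,
      (0 < c.1.2 -> \forall n \near \oo, (a n).2 = c.2),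
      (c.1.2 = 0 -> \forall n \near \oo, (a n).1.2 = 0%N) &
      0 <= c.1.2 <= c.1.1 /\ (forall n, ((a n).1.2 <= (a n).1.1 <= n)%N)].

Lemma piv_bounds n y : 0 <= y <= 1 -> n%:R * y <= (piv n y)%:R <= n%:R * y + 1.
Proof.
move=> /andP[y0 y1]; rewrite /piv natr_min.
have ny0 : 0 <= n%:R * y by rewrite mulr_ge0.
have /andP[h1 h2] := truncn_itv ny0.
rewrite le_min ge_min (ltW h2) andbT -natr1 [X in _ || X]lerD2r h1 orbT andbT.
by rewrite ler_piMr.
Qed.

Lemma state_cvg_piv a c y : 0 <= y <= 1 -> state_cvg a c ->
  (piv (a n).1.1 y)%:R / n%:R @[n --> \oo] --> c.1.1 * y.
Proof.
move=> y01 [al _ _ _ _]; apply: (@cvg_div_close _ _ (fun n => (a n).1.1%:R * y)).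
  move=> n; have /andP[h1 h2] := piv_bounds (a n).1.1 y01.
  by rewrite ler_norml; apply/andP; split; lra.
apply: cvg_near_eq (cvgM al (cvg_cst y)) => //.
by near=> n => /=; rewrite mulrAC.
Unshelve. all: by end_near. Qed.

Lemma near_lt_cvg (f g : nat -> R) (a b : R) : a < b ->
  f n @[n --> \oo] --> a -> g n @[n --> \oo] --> b -> \forall n \near \oo, f n < g n.
Proof.
move=> ab fa gb; near=> n.
have h1 : f n < (a + b) / 2 by near: n; apply: (cvgr_lt _ fa); lra.
have h2 : (a + b) / 2 < g n by near: n; apply: (cvgr_gt _ gb); lra.
exact: lt_trans h1 h2.
Unshelve. all: by end_near. Qed.

Lemma near_ltn_cvg (k m : nat -> nat) (a b : R) : a < b ->
  (k n)%:R / n%:R @[n --> \oo] --> a -> (m n)%:R / n%:R @[n --> \oo] --> b ->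
  \forall n \near \oo, (k n < m n)%N.
Proof.
move=> ab ka mb; near=> n.
have n0 : (0 < n)%N by near: n; exact: nbhs_infty_gt.
have : (k n)%:R / n%:R < (m n)%:R / n%:R :> R by near: n; exact: (near_lt_cvg ab ka mb).
by rewrite ltr_pM2r ?ltr_nat // invr_gt0 ltr0n.
Unshelve. all: by end_near. Qed.

Lemma cvg_min (f g : nat -> R) (a b : R) :
  f n @[n --> \oo] --> a -> g n @[n --> \oo] --> b ->
  Num.min (f n) (g n) @[n --> \oo] --> Num.min a b.
Proof.
move=> fa gb; rewrite minr_absE.
apply: (cvg_near_eq _ _
  (cvgM (cvgB (cvgD fa gb) (cvg_norm (cvgB fa gb))) (cvg_cst (2^-1 : R)))) => //.
by near=> n; rewrite /= ?fctE minr_absE.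
Unshelve. all: by end_near. Qed.

Lemma cvg_max (f g : nat -> R) (a b : R) :
  f n @[n --> \oo] --> a -> g n @[n --> \oo] --> b ->
  Num.max (f n) (g n) @[n --> \oo] --> Num.max a b.
Proof.
move=> fa gb; rewrite maxr_absE.
apply: (cvg_near_eq _ _
  (cvgM (cvgD (cvgD fa gb) (cvg_norm (cvgB fa gb))) (cvg_cst (2^-1 : R)))) => //.
by near=> n; rewrite /= ?fctE maxr_absE.
Unshelve. all: by end_near. Qed.

(** By [good_label] a positive limit rank differs strictly from the limit pivot, so for large [n]
    the discrete comparison of rank and pivot has the same outcome as the limit one. *)
Lemma state_cvg_step a c y b : 0 < y < 1 -> good_label c y -> state_cvg a c ->
  state_cvg (fun n => dstep y b (a n)) (cstep y b c).
Proof.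
move=> /andP[y0 y1]; case: c => [[l s] f] gl ac.
have y01 : 0 <= y <= 1 by rewrite (ltW y0) (ltW y1).
have pI := state_cvg_piv y01 ac.
case: (ac) => /= al as_ af a0 [/andP[s0 sl] an].
move: gl; rewrite /good_label /= => gl.
have l0 : 0 <= l by exact: le_trans sl.
have p0 : 0 <= l * y by rewrite mulr_ge0 // ltW.
have pl : l * y <= l by rewrite ler_piMr // ltW.
have pI' : ((piv (a n).1.1 y).-1)%:R / n%:R @[n --> \oo] --> l * y.
  apply: (@cvg_div_close _ _ (fun n => (piv (a n).1.1 y)%:R)) => // n.
  case: (piv _ _) => [|q] /=; first by rewrite subrr normr0.
  by rewrite -[q.+1%:R]natr1 opprD addrA subrr add0r normrN normr1.
have an' n := andP (an n).
split.
- case: b => /=; last by apply: cvg_near_eq pI' => //; near=> n; case: (a n) => [[? ?] ?].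
  apply: cvg_near_eq (cvgB al pI) => //; near=> n.
  have := piv_le (a n).1.1 y; rewrite ?fctE.
  by case: (a n) => [[m k] g] /= pm; rewrite natrB // mulrBl.
- case: b => /=.
    apply: cvg_near_eq (cvg_max (cvg_cst (0 : R)) (cvgB as_ pI)) => //; near=> n.
    rewrite ?fctE /=; case: (a n) => [[m k] g] /=; set q := piv _ _; rewrite -mulrBl.
    have [kq|qk] := leqP k q.
      rewrite (eqP (kq : (k - q == 0)%N)) mul0r; apply/max_idPl.
      by rewrite mulr_le0_ge0 ?invr_ge0 // subr_le0 ler_nat.
    rewrite natrB ?(ltnW qk) //; apply/max_idPr.
    by rewrite mulr_ge0 ?invr_ge0 // subr_ge0 ler_nat ltnW.
  apply: cvg_near_eq (cvg_min as_ pI') => //; near=> n.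
  case: (a n) => [[m k] g] /=; set q := (piv _ _).-1.
  by rewrite natr_min -minr_pMl ?invr_ge0.
- case: b => /=.
    rewrite lt_max ltxx /= subr_gt0 => ps.
    have := af (le_lt_trans p0 ps); apply: filterS => n.
    by case: (a n) => [[m k] g] /= ->.
  rewrite lt_min => /andP[s0' p0']; have fn := af s0'.
  have [sp|ps] := ltP s (l * y).
    near=> n; have kq : ((a n).1.2 < piv (a n).1.1 y)%N by near: n; exact: (near_ltn_cvg sp as_ pI).
    have : (a n).2 = f by near: n.
    by move: kq; case: (a n) => [[m k] g] /= -> ->.
  have {}ps : l * y < s by rewrite lt_neqAle ps andbT eq_sym gl.
  near=> n; have kq : (piv (a n).1.1 y < (a n).1.2)%N by near: n; exact: (near_ltn_cvg ps pI as_).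
  have : (a n).2 = f by near: n.
  by move: kq; case: (a n) => [[m k] g] /= kq ->; rewrite ltnNge (ltnW kq).
- case: b => /=.
    (* A right rank with limit zero: either [s] was already zero, or [s] is strictly below the split
       point and truncated subtraction gives exactly zero for large [n]. *)
    move=> E; have : s - l * y <= 0 by rewrite -E le_max lexx orbT.
    rewrite subr_le0 => sp; move: s0; rewrite le_eqVlt => /predU1P[s0|s0].
      have := a0 (esym s0); apply: filterS => n; case: (a n) => [[m k] g] /= ->.
      by rewrite sub0n.
    have {}sp : s < l * y by rewrite lt_neqAle gl.
    near=> n; have : ((a n).1.2 < piv (a n).1.1 y)%N by near: n; exact: (near_ltn_cvg sp as_ pI).
    by case: (a n) => [[m k] g] /= /ltnW; rewrite -subn_eq0 => /eqP.
  move=> E; have s00 : s = 0.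
    apply/eqP; rewrite eq_le s0 andbT leNgt; apply/negP => s0'.
    by have := lt_min 0 s (l * y); rewrite E ltxx s0' mulr_gt0 // (lt_le_trans s0').
  have := a0 s00; apply: filterS => n; case: (a n) => [[m k] g] /= ->.
  by rewrite min0n.
- split.
    case: b => /=; last by rewrite le_min s0 p0 ge_min lexx orbT.
    by rewrite le_max lexx /= ge_max subr_ge0 pl lerB.
  move=> n; have [kn nn] := an' n; have := piv_le (a n).1.1 y.
  case: (a n) kn nn => [[m k] g] /=; set q := piv _ _ => km mn qm; case: b => /=.
    by rewrite leq_sub2r // (leq_trans (leq_subr _ _) mn).
  by rewrite geq_minr (leq_trans (leq_pred q)) // (leq_trans qm mn).
Unshelve. all: by end_near. Qed.

(** If the limit rank were at the split point, the gap divided by [n] would tend to 0 while the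
    tolerance tends to [e] times a positive length. Rank and pivot would then be close for all large
    [n], for every [e]. *)
Lemma state_cvg_good a c y : 0 < y < 1 -> state_cvg a c ->
  (exists2 e : R, 0 < e & forall N, exists2 n, (N <= n)%N &
     ~~ ((0 < (a n).1.2)%N && (`|(a n).1.2%:R - (a n).1.1%:R * y| <= e * (a n).1.1%:R))) ->
  good_label c y.
Proof.
move=> /andP[y0 y1] [al as_ _ _ [/andP[s0 sl] an]] [e e0 He] s0'; apply/negP => /eqP E.
have l0 : 0 < c.1.1 by exact: lt_le_trans sl.
have d0 : `|(a n).1.2%:R / n%:R - (a n).1.1%:R / n%:R * y| @[n --> \oo] --> (0 : R).
  rewrite -[X in _ --> X](@normr0 _ R) -(subrr (c.1.1 * y)) -{1}E.
  by apply: cvg_norm; apply: cvgB => //; apply: cvgM => //; exact: cvg_cst.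
have el : e * ((a n).1.1%:R / n%:R) @[n --> \oo] --> e * c.1.1.
  by apply: cvgM => //; exact: cvg_cst.
have el0 : 0 < e * c.1.1 by rewrite mulr_gt0.
have [N _ HN] : \forall n \near \oo, ((0 < (a n).1.2)%N &&
    (`|(a n).1.2%:R - (a n).1.1%:R * y| <= e * (a n).1.1%:R)).
  near=> n; have n0 : (0 < n)%N by near: n; exact: nbhs_infty_gt.
  apply/andP; split; first by near: n; exact: (cvg_nat_near_gt 0 s0' as_).
  have : `|(a n).1.2%:R / n%:R - (a n).1.1%:R / n%:R * y| < e * ((a n).1.1%:R / n%:R).
    by near: n; exact: (near_lt_cvg el0 d0 el).
  rewrite mulrAC -mulrBl normrM [`|n%:R^-1|]ger0_norm ?invr_ge0 // mulrA.
  by rewrite ltr_pM2r ?invr_gt0 ?ltr0n // => /ltW.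
by have [n Nn /negP] := He N; apply; exact: HN.
Unshelve. all: by end_near. Qed.

Lemma cvg_bigD (I : Type) (r : seq I) (F : I -> nat -> R) (L : I -> R) :
  (forall i, F i n @[n --> \oo] --> L i) ->
  \sum_(i <- r) F i n @[n --> \oo] --> \sum_(i <- r) L i.
Proof.
move=> FL; elim: r => [|i r IH].
  by rewrite big_nil; under eq_fun do rewrite big_nil; exact: cvg_cst.
by rewrite big_cons; under eq_fun do rewrite big_cons; exact: cvgD.
Qed.

Lemma xlnx_mul (x : R) : xlnx x = x * ln x.
Proof. by rewrite /xlnx; case: eqP => // ->; rewrite mul0r. Qed.

Lemma toll_cvg_right a l s f y : 0 < y < 1 -> l * y < s -> live f ->
  state_cvg a (l, s, f) ->
  dtoll R (a n) (piv (a n).1.1 y) / n%:R @[n --> \oo] --> l * Cf y.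
Proof.
move=> /andP[y0 y1] ps lf ac.
have y01 : 0 <= y <= 1 by rewrite (ltW y0) (ltW y1).
have /= pI := state_cvg_piv y01 ac.
have [/= al as_ af _ [/andP[s0' sl] an]] := ac.
have l0 : 0 < l.
  rewrite lt_neqAle (le_trans s0' sl) andbT; apply/eqP => E.
  by move: ps sl; rewrite -E mul0r => h1 h2; have := lt_le_trans h1 h2; rewrite ltxx.
have s0 : 0 < s by apply: lt_trans ps; rewrite mulr_gt0.
have pl : l * (1 - y) = l - l * y by ring.
have p0 : 0 < l * y by rewrite mulr_gt0.
have p1 : 0 < l * (1 - y) by rewrite mulr_gt0 // subr_gt0.
pose q n := piv (a n).1.1 y.
have pI' : (q n).-1%:R / n%:R @[n --> \oo] --> l * y.
  apply: (@cvg_div_close _ _ (fun n => (q n)%:R)) => // n.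
  case: (q n) => [|k] /=; first by rewrite subrr normr0.
  by rewrite -[k.+1%:R]natr1 opprD addrA subrr add0r normrN normr1.
have aI : ((a n).1.1 - q n)%:R / n%:R @[n --> \oo] --> l * (1 - y).
  rewrite pl; apply: cvg_near_eq (cvgB al pI) => //; near=> n.
  by rewrite /= ?fctE /= natrB ?piv_le // mulrBl.
have H1 : harm R (q n).-1 - harm R n @[n --> \oo] --> ln (l * y).
  apply: cvg_harm_ln => // n; have /andP[_ mn] := an n.
  by rewrite (leq_trans (leq_pred _)) // (leq_trans (piv_le _ _)).
have H2 : harm R ((a n).1.1 - q n) - harm R n @[n --> \oo] --> ln (l * (1 - y)).
  apply: cvg_harm_ln => // n; have /andP[_ mn] := an n.
  by rewrite ?(leq_trans (leq_subr _ _)).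
have H3 : harm R (a n).1.1 - harm R n @[n --> \oo] --> ln l.
  apply: cvg_harm_ln => // n; have /andP[_ mn] := an n.
  by rewrite ?(leq_trans (leq_subr _ _)).
(* The normalized toll with [harm R n] subtracted from each harmonic number; this is harmless
   because the coefficients [2 i + 2 (m - i + 1) - 2 (m + 1)] sum to zero. *)
apply: cvg_near_eq (cvgD (cvgB (cvgD (cvgM (cvgM (cvg_cst (2 : R)) pI) H1)
    (cvgM (cvgM (cvg_cst (2 : R)) (cvgD aI (@cvg_natV R))) H2))
    (cvgM (cvgM (cvg_cst (2 : R)) (cvgD al (@cvg_natV R))) H3))
    (cvgD al (cvgM (cvg_cst (3 : R)) (@cvg_natV R)))).
  near=> n; rewrite /= ?fctE /=.
  have n0 : (0 < n)%N by near: n; exact: nbhs_infty_gt.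
  have a1 : (1 < (a n).1.1)%N by near: n; exact: (cvg_nat_near_gt 1 l0 al).
  have q0 : (0 < q n)%N by near: n; exact: (cvg_nat_near_gt 0 p0 pI).
  have ql : (q n < (a n).1.2)%N by near: n; exact: (near_ltn_cvg ps pI as_).
  have fE : (a n).2 = f by near: n; exact: af.
  have := an n; have := piv_le (a n).1.1 y; rewrite -/(q n).
  case: (a n) a1 q0 ql fE => [[m k] g] /=; move: (q n) => i.
  move=> m1 i0 ik -> im /andP[km mn].
  rewrite lf orbF (gtn_eqF (leq_ltn_trans (leq0n i) ik)) orbF leqNgt m1 /=.
  have /minn_idPr -> : (i.-1 <= k)%N by clear -ik; lia.
  rewrite mean_cmpnn /mean_cmp (gtn_eqF (leq_ltn_trans (leq0n i) ik)).
  rewrite (gtn_eqF (_ : 0 < k - i)%N) ?subn_gt0 //.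
  (* Right sublist and whole list share this harmonic number with equal coefficients. It cancels, so
     the limit does not depend on the rank. *)
  have -> : ((m - i).+1 - (k - i) = m.+1 - k)%N by clear -ik im; lia.
  rewrite prednK // !(natrB, =^~ natr1) //; last exact: ltnW.
  have -> : i.-1%:R = i%:R - 1 :> R by rewrite -[in RHS](prednK i0) -natr1 addrK.
  by field; rewrite pnatr_eq0 -lt0n.
rewrite /Cf !xlnx_mul !lnM ?posrE ?subr_gt0 //.
by rewrite !addr0 mulr0; ring.
Unshelve. all: by end_near. Qed.

Lemma toll_cvg_left a l s f y : 0 < y < 1 -> 0 < s < l * y -> live f ->
  state_cvg a (l, s, f) ->
  dtoll R (a n) (piv (a n).1.1 y) / n%:R @[n --> \oo] --> l * Ctx (s / l) y.
Proof.
move=> /andP[y0 y1] /andP[s0 sp] lf ac.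
have y01 : 0 <= y <= 1 by rewrite (ltW y0) (ltW y1).
have /= pI := state_cvg_piv y01 ac.
have [/= al as_ af _ [/andP[s0' sl] an]] := ac.
have l0 : 0 < l by exact: lt_le_trans sl.
have p0 : 0 < l * y by rewrite mulr_gt0.
have [t st] : {t | s = l * t} by exists (s / l); rewrite mulrC divfK // gt_eqF.
have ty : t < y by move: sp; rewrite st ltr_pM2l.
have t1 : t < 1 by exact: lt_trans y1.
have p1 : 0 < l * (y - t) by rewrite mulr_gt0 // subr_gt0.
have p2 : 0 < l * (1 - t) by rewrite mulr_gt0 // subr_gt0.
pose q n := piv (a n).1.1 y.
have pI' : (q n).-1%:R / n%:R @[n --> \oo] --> l * y.
  apply: (@cvg_div_close _ _ (fun n => (q n)%:R)) => // n.
  case: (q n) => [|k] /=; first by rewrite subrr normr0.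
  by rewrite -[k.+1%:R]natr1 opprD addrA subrr add0r normrN normr1.
have qI : (q n - (a n).1.2)%:R / n%:R @[n --> \oo] --> l * (y - t).
  rewrite mulrBr -st; apply: cvg_near_eq (cvgB pI as_) => //; near=> n.
  rewrite /= ?fctE /= natrB ?mulrBl //.
  by apply: ltnW; near: n; exact: (near_ltn_cvg sp as_ pI).
have aI : ((a n).1.1 - (a n).1.2.-1)%:R / n%:R @[n --> \oo] --> l * (1 - t).
  apply: (@cvg_div_close _ _ (fun n => (a n).1.1%:R - (a n).1.2%:R)) => [n|].
    move: (an n); case: (a n) => [[m k] g] /= /andP[km _].
    rewrite (natrB _ (leq_trans (leq_pred k) km)).
    case: k {km} => [|k] /=; first by rewrite subrr normr0.
    rewrite -[k.+1%:R]natr1 (_ : _ - _ - _ = 1) ?normr1 //; ring.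
  rewrite mulrBr mulr1 -st; apply: cvg_near_eq (cvgB al as_) => //; near=> n.
  by rewrite /= ?fctE /= mulrBl.
have H1 : harm R (q n).-1 - harm R n @[n --> \oo] --> ln (l * y).
  apply: cvg_harm_ln => // n; have /andP[_ mn] := an n.
  by rewrite (leq_trans (leq_pred _)) // (leq_trans (piv_le _ _)).
have H2 : harm R (q n - (a n).1.2) - harm R n @[n --> \oo] --> ln (l * (y - t)).
  apply: cvg_harm_ln => // n; have /andP[_ mn] := an n.
  by rewrite (leq_trans (leq_subr _ _)) // (leq_trans (piv_le _ _)).
have H3 : harm R (a n).1.1 - harm R n @[n --> \oo] --> ln l.
  apply: cvg_harm_ln => // n; have /andP[_ mn] := an n.
  by rewrite ?(leq_trans (leq_subr _ _)).
have H4 : harm R ((a n).1.1 - (a n).1.2.-1) - harm R n @[n --> \oo] --> ln (l * (1 - t)).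
  apply: cvg_harm_ln => // n; have /andP[_ mn] := an n.
  by rewrite ?(leq_trans (leq_subr _ _)).
have v := @cvg_natV R; have v2 := cvgM (cvg_cst (2 : R)) v.
(* The coefficients of [harm R n] again sum to zero. Two harmonic numbers now depend on the rank,
   which produces the terms in [1 - t] and [y - t] of [Ctx]. *)
apply: cvg_near_eq (cvgD (cvgB (cvgB (cvgD (cvgM (cvg_cst (2 : R)) pI) 
      (cvgM (cvgM (cvg_cst (2 : R)) pI) H1))
      (cvgM (cvgM (cvg_cst (2 : R)) (cvgD qI (cvgM (cvg_cst (2 : R)) v))) H2))
      (cvgM (cvgM (cvg_cst (2 : R)) (cvgD al v)) H3))
    (cvgB (cvgM (cvgM (cvg_cst (2 : R)) (cvgD aI (cvgM (cvg_cst (2 : R)) v))) H4)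
      (cvgD al (cvgM (cvg_cst (3 : R)) v)))).
  near=> n; rewrite /= ?fctE /=.
  have n0 : (0 < n)%N by near: n; exact: nbhs_infty_gt.
  have a1 : (1 < (a n).1.1)%N by near: n; exact: (cvg_nat_near_gt 1 l0 al).
  have k0 : (0 < (a n).1.2)%N by near: n; exact: (cvg_nat_near_gt 0 s0 as_).
  have kq : ((a n).1.2 < q n)%N by near: n; exact: (near_ltn_cvg sp as_ pI).
  have fE : (a n).2 = f by near: n; exact: af.
  have := an n; have := piv_le (a n).1.1 y; rewrite -/(q n).
  case: (a n) a1 k0 kq fE => [[m k] g] /=; move: (q n) => i.
  move=> m1 k0 ki -> im /andP[km mn].
  have i0 : (0 < i)%N by clear -ki; lia.
  rewrite lf orbF (gtn_eqF k0) orbF leqNgt m1 /=.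
  have /minn_idPl -> : (k <= i.-1)%N by clear -ki; lia.
  have -> : (k - i = 0)%N by clear -ki; lia.
  rewrite mean_cmp0 addr0 /mean_cmp (gtn_eqF k0).
  have -> : (i.-1.+1 - k = i - k)%N by clear -ki; lia.
  have -> : (m.+1 - k = m - k.-1)%N by clear -k0 km; lia.
  rewrite prednK // -[m.+3]addn3 -[i.+2]addn2 [in (m - k.-1)%:R]natrB; last by clear -km; lia.
  rewrite natrB ?(ltnW ki) // !(natrD, =^~ natr1).
  have -> : i.-1%:R = i%:R - 1 :> R by rewrite -[in RHS](prednK i0) -natr1 addrK.
  have -> : k.-1%:R = k%:R - 1 :> R by rewrite -[in RHS](prednK k0) -natr1 addrK.
  by field; rewrite pnatr_eq0 -lt0n.
rewrite st (mulrC l t) mulfK ?gt_eqF // /Ctx ty /Cf.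
rewrite !xlnx_mul !lnM ?posrE ?subr_gt0 //.
by rewrite !mulr0 !addr0; ring.
Unshelve. all: by end_near. Qed.

Lemma toll_cvg a c y : 0 < y < 1 -> good_label c y -> state_cvg a c ->
  dtoll R (a n) (piv (a n).1.1 y) / n%:R @[n --> \oo] --> ctoll c y.
Proof.
case: c => [[l s] f] y01 gl ac; rewrite /ctoll.
have [/= al as_ af a0 [/andP[s0 sl] an]] := ac.
have [s0'|s0'] := ltP 0 s; last first.
  have := a0 (le_anti (_ : s <= 0 <= s)); rewrite s0 s0' => /(_ isT) a0'.
  apply: cvg_near_eq (cvg_cst (0 : R)) => //; near=> n.
  have : (a n).1.2 = 0%N by near: n.
  by case: (a n) => [[m k] g] /= ->; rewrite orbT mul0r.
case: (boolP (live f)) => [lf|lf] /=; last first.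
  apply: cvg_near_eq (cvg_cst (0 : R)) => //; near=> n.
  have : (a n).2 = f by near: n; exact: af.
  by case: (a n) => [[m k] g] /= ->; rewrite lf !orbT mul0r.
have l0 : 0 < l by exact: lt_le_trans sl.
have [sp|ps] := ltP s (l * y); first by apply: (toll_cvg_left y01 _ lf ac); rewrite s0' sp.
rewrite /Ctx ltr_pdivrMr // (mulrC y l) ltNge ps /= mulr0 addr0.
apply: (toll_cvg_right y01 _ lf ac).
by rewrite lt_neqAle ps andbT eq_sym; exact: gl.
Unshelve. all: by end_near. Qed.

Section Run.
Variables (u : word -> R) (a : nat -> dstate) (c : cstate).
Hypothesis u01 : forall w, 0 < u w < 1.
Hypothesis ac : state_cvg a c.
Hypothesis far : forall w, exists2 e : R, 0 < e & forall N, exists2 n, (N <= n)%N &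
  let s := run (@dstep R) u (a n) w in
  ~~ ((0 < s.1.2)%N && (`|s.1.2%:R - s.1.1%:R * u w| <= e * s.1.1%:R)).

Lemma run_cvg w : state_cvg (fun n => run (@dstep R) u (a n) w) (run cstep u c w) /\
  good_label (run cstep u c w) (u w).
Proof.
suff H : state_cvg (fun n => run (@dstep R) u (a n) w) (run cstep u c w).
  by split => //; exact: state_cvg_good (u01 w) H (far w).
elim/last_ind: w => [//|w b IH].
have gl := state_cvg_good (u01 w) IH (far w).
rewrite run_rcons; have := state_cvg_step b (u01 w) gl IH; congr state_cvg.
by apply/funext => n; rewrite run_rcons.
Qed.

Lemma sum_dterm_cvg m :
  sumVlt m (dterm u (a n)) / n%:R @[n --> \oo] --> sumVlt m (cterm u c).
Proof.
rewrite [X in X @ _ --> _](_ : _ = fun n => \sum_(j < m) \sum_(w : j.-tuple bool)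
    dterm u (a n) w / n%:R); last first.
  by apply/funext => n; rewrite mulr_suml; apply: eq_bigr => j _; rewrite mulr_suml.
apply: cvg_bigD => j; apply: cvg_bigD => w; have [h1 h2] := run_cvg w.
exact: toll_cvg.
Qed.

End Run.

Lemma start_cvg t f : 0 < t <= 1 -> state_cvg (start t ^~ f) (1, t, f).
Proof.
move=> /andP[t0 t1]; split => //=.
- apply: cvg_near_eq (cvg_cst (1 : R)) => //; near=> n.
  have n0 : (0 < n)%N by near: n; exact: nbhs_infty_gt.
  by rewrite divff // pnatr_eq0 -lt0n.
- apply: (@cvg_div_close _ _ (fun n => n%:R * t)) => [n|].
    have nt0 : 0 <= n%:R * t by rewrite mulr_ge0 // ltW.
    have /andP[h1 h2] := truncn_itv nt0; rewrite -natr1 in h2.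
    by rewrite ler_norml; apply/andP; split; lra.
  apply: cvg_near_eq (cvg_cst t) => //; near=> n.
  have n0 : (0 < n)%N by near: n; exact: nbhs_infty_gt.
  by rewrite mulrAC divff ?mul1r // pnatr_eq0 -lt0n.
- by move=> _; near=> n.
- by move=> t0'; move: t0; rewrite t0' ltxx.
- split; first by rewrite (ltW t0).
  by move=> n; rewrite leqnn andbT; apply: (@start_le R t n f); rewrite (ltW t0).
Unshelve. all: by end_near. Qed.

End LimitStates.

(** * Almost sure and L1 convergence criteria *)

Section MeasurableLimits.
Context d (T : measurableType d) (R : realType).

(** The set of convergence is measurable by the Cauchy criterion, and off it [limn] has the constant
    default value [point]. *)
Lemma measurable_limn (f : nat -> T -> R) : (forall m, measurable_fun setT (f m)) ->
  measurable_fun setT (fun x => limn (fun m => f m x)).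
Proof.
move=> mf.
pose C := \bigcap_k \bigcup_N \bigcap_m [set x | `|f (N + m)%N x - f N x| <= k.+1%:R^-1].
have mC : measurable C.
  apply: bigcapT_measurable => k; apply: bigcupT_measurable => N.
  apply: bigcapT_measurable => m.
  rewrite (_ : [set x | _] =
    setT `&` (fun x => `|f (N + m)%N x - f N x| <= k.+1%:R^-1) @^-1` [set true]);
    last by rewrite setTI.
  apply: measurable_fun_ler => //.
  by apply: measurableT_comp => //; exact: measurable_funB.
have CP x : C x <-> cvgn (fun m => f m x).
  split=> [Cx|/cvg_ex[l fl]].
    apply/cauchy_cvgP; apply: cauchy_exP => e e0.
    have [k ke] : exists k, k.+1%:R^-1 < e.
      have := cvgr_lt _ (@cvg_harmonic R) e e0; case=> k _ /(_ k (leqnn _)) ke.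
      by exists k.
    have [N _ HN] := Cx k I; exists (f N x); exists N => // m /= Nm.
    have := HN (m - N)%N I; rewrite /= subnKC // => h.
    by rewrite /ball /= distrC (le_lt_trans h).
  move=> k _; have k0 : 0 < k.+1%:R^-1 / 2 :> R by rewrite divr_gt0 // invr_gt0.
  have [N _ HN] : \forall n \near \oo, `|l - f n x| <= k.+1%:R^-1 / 2.
    by apply: cvgr_dist_le => //; exact: fl.
  exists N => // m _ /=.
  have h1 := HN (N + m)%N (leq_addr _ _); have h2 := HN N (leqnn _).
  rewrite -(subrKA l) (le_trans (ler_normD _ _)) // [leRHS]splitr lerD //.
  by rewrite distrC.
have mI : measurable_fun setT (\1_C : T -> R) by exact: measurable_indic.
have -> : (fun x => limn (fun m => f m x)) = fun x =>
    if x \in C then limn (fun m => f m x * \1_C x) else point.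
  apply/funext => x; case: ifPn => xC; last first.
    rewrite dvgP // => /CP Cx; by rewrite mem_set in xC.
  by congr (limn _); apply/funext => m; rewrite indicE xC mulr1.
apply: measurable_fun_ifT => //.
  apply: (measurable_fun_bool true); rewrite setTI.
  rewrite (_ : _ @^-1` _ = C) //; apply/seteqP; split => x /=; last exact: mem_set.
  by move=> h; exact: set_mem h.
apply: (@measurable_fun_cvg _ _ _ _ (fun m x => f m x * \1_C x)) => [m|x _].
  exact: measurable_funM.
rewrite indicE; case: (boolP (x \in C)) => [|_].
  rewrite inE => /CP Cx; have E : (fun m => f m x * true%:R) = fun m => f m x.
    by apply/funext => m; rewrite mulr1.
  by rewrite E; exact: Cx.
have E : (fun m => f m x * false%:R) = cst 0 by apply/funext => m; rewrite mulr0.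
by rewrite E lim_cst //; exact: cvg_cst.
Qed.

Lemma measurable_countable_comp (C : countType) (N : T -> C) (h : C -> R) :
  (forall c, measurable (N @^-1` [set c])) -> measurable_fun setT (h \o N).
Proof.
move=> mN _ B mB; rewrite setTI.
rewrite (_ : _ @^-1` _ = \bigcup_n
   (if unpickle n is Some c then if `[< B (h c) >] then N @^-1` [set c] else set0 else set0)).
  by apply: bigcupT_measurable => n; case: unpickle => // c; case: ifP.
apply/seteqP; split => x /=.
  by move=> Bx; exists (pickle (N x)) => //; rewrite pickleK asboolT.
by move=> [n _]; case: unpickle => // c; case: asboolP => // Bc /= ->.
Qed.

Lemma cvg_row k (a : nat -> 'I_k -> R) (b : 'I_k -> R) :
  (forall i, a n i @[n --> \oo] --> b i) ->
  (\row_i a n i) @[n --> \oo] --> \row_i b i.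
Proof.
move=> ab; apply/cvg_ballP => e e0.
have H : \forall n \near \oo, forall i, `|b i - a n i| < e.
  by apply: filter_forall => i; apply: cvgr_dist_lt => //; exact: ab.
near=> n; split => // i j; rewrite !mxE.
have : forall i, `|b i - a n i| < e by near: n.
exact.
Unshelve. all: by end_near. Qed.

Lemma floor_approx_cvg (z : R) : (Num.floor (n.+1%:R * z))%:~R / n.+1%:R @[n --> \oo] --> z.
Proof.
have h : z - (Num.floor (n.+1%:R * z))%:~R / n.+1%:R @[n --> \oo] --> (0 : R).
  apply: (@squeeze_cvgr _ _ _ _ (cst 0) (fun n => n.+1%:R^-1)).
  - near=> n; have n0 : 0 < n.+1%:R :> R by rewrite ltr0n.
    have /andP[h1 h2] := floor_itv (n.+1%:R * z).
    rewrite intrD in h2.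
    rewrite (_ : z - _ = (n.+1%:R * z - (Num.floor (n.+1%:R * z))%:~R) / n.+1%:R); last first.
      by field; rewrite gt_eqF.
    rewrite divr_ge0 ?subr_ge0 //= ler_pdivrMr // mulVf ?gt_eqF //.
    by rewrite lerBlDr addrC ltW.
  - exact: cvg_cst.
  - exact: cvg_harmonic.
apply: cvg_near_eq (cvgB (cvg_cst z) h); last by rewrite subr0.
by near=> n; rewrite /= ?fctE /= subKr.
Unshelve. all: by end_near. Qed.

(** Rounding the coordinates down to multiples of [1 / (n+1)] leaves countably many values, where
    measurability is elementary; continuity of [f] then gives a pointwise limit. *)
Lemma measurable_continuous_row k (f : 'rV[R]_k -> R) (Z : 'I_k -> T -> R) :
  continuous f -> (forall i, measurable_fun setT (Z i)) ->
  measurable_fun setT (fun x => f (\row_i Z i x)).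
Proof.
move=> cf mZ.
pose N n x : {ffun 'I_k -> int} := [ffun i => Num.floor (n.+1%:R * Z i x)].
pose h n (c : {ffun 'I_k -> int}) := f (\row_i ((c i)%:~R / n.+1%:R)).
apply: (@measurable_fun_cvg _ _ _ _ (fun n => h n \o N n)) => [n|x _].
  apply: measurable_countable_comp => c.
  rewrite (_ : _ @^-1` _ = \bigcap_(i in [set: 'I_k])
      ((fun x => n.+1%:R * Z i x) @^-1` `[(c i)%:~R, (c i + 1)%:~R[%classic)).
    apply: fin_bigcap_measurable => // i _; rewrite -[X in measurable X]setTI.
    have : measurable_fun setT (fun x => n.+1%:R * Z i x) by exact: measurable_funM.
    by apply.
  apply/seteqP; split => x /=.
    by move=> <- i _ /=; rewrite in_itv /= ffunE; exact: floor_itv.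
  move=> H; apply/ffunP => i; rewrite ffunE; apply: floor_def.
  by have := H i I; rewrite /= in_itv.
apply: continuous_cvg; first exact: cf.
by under eq_fun do under eq_mx do rewrite ffunE; apply: cvg_row => i; exact: floor_approx_cvg.
Qed.

End MeasurableLimits.

(** * Consequences of L1 bounds: almost sure limits, Fatou, convergence in distribution *)

Section Convergence.
Context d (T : measurableType d) (R : realType) (P : probability T R).
Implicit Types (X Y Z g : T -> R).

Lemma sum_geometric_le (c : R) n : 0 <= c -> \sum_(0 <= m < n) c * (5 / 6) ^+ m <= 6 * c.
Proof.
move=> c0; suff -> : \sum_(0 <= m < n) c * (5 / 6) ^+ m = 6 * c * (1 - (5 / 6) ^+ n).
  by rewrite ler_piMr ?mulr_ge0 // gerBl exprn_ge0 // divr_ge0.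
elim: n => [|n IH]; first by rewrite big_geq // subrr mulr0.
by rewrite big_nat_recr //= IH exprS; move: (_ ^+ n) => a; field.
Qed.

(** The sum of the absolute values has integral at most [6 * c], with 6 = 1 / (1 - 5/6), hence is
    almost surely finite. *)
Lemma summable_ae (g : nat -> T -> R) (c : R) : 0 <= c ->
  (forall m, measurable_fun setT (g m)) ->
  (forall m, (\int[P]_x `|g m x|%:E <= (c * (5 / 6) ^+ m)%:E)%E) ->
  {ae P, forall x, cvgn (series (fun m => `|g m x|))}.
Proof.
move=> c0 mg gc.
have mga m : measurable_fun setT (fun x => `|g m x|%:E).
  by apply/measurable_EFinP; exact: measurableT_comp.
pose S x := (\sum_(m <oo) `|g m x|%:E)%E.
have mS : measurable_fun setT S.
  by apply: ge0_emeasurable_sum => // m x _ _; rewrite lee_fin.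
have S0 x : (0 <= S x)%E by apply: nneseries_ge0 => m _ _; rewrite lee_fin.
have iS : P.-integrable setT S.
  apply/integrableP; split => //.
  under eq_integral do rewrite gee0_abs //.
  rewrite integral_nneseries //.
  apply: (@le_lt_trans _ _ (6 * c)%:E); last by rewrite ltry.
  apply: lime_le.
    by apply: is_cvg_nneseries => m _ _; apply: integral_ge0 => x _; rewrite lee_fin.
  near=> n; apply: (@le_trans _ _ (\sum_(0 <= m < n) (c * (5 / 6) ^+ m)%:E)%E).
    exact: lee_sum.
  by rewrite sumEFin lee_fin sum_geometric_le.
apply: filterS (integrable_ae measurableT iS) => x /(_ I) Sfin.
apply: nondecreasing_is_cvgn.
  by apply: (@nondecreasing_series _ _ xpredT) => m _ _.
exists (fine (S x)) => _ [n _ <-]; rewrite -lee_fin fineK // /series /= -sumEFin.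
by apply: (@nneseries_lim_ge _ _ xpredT) => m _ _; rewrite lee_fin.
Unshelve. all: by end_near. Qed.

Lemma fatou_abs (X : nat -> T -> R) Y (c : \bar R) :
  (forall n, measurable_fun setT (X n)) -> measurable_fun setT Y ->
  {ae P, forall x, X n x @[n --> \oo] --> Y x} ->
  (forall n, (\int[P]_x `|X n x|%:E <= c)%E) ->
  (\int[P]_x `|Y x|%:E <= c)%E.
Proof.
move=> mX mY [N [mN N0 XY]] Xc.
have mD : measurable (~` N) by exact: measurableC.
(* Killing the functions on a null set makes the convergence hold everywhere, as Fatou's lemma
   requires. *)
pose X' n x : R := X n x * \1_(~` N) x; pose Y' x : R := Y x * \1_(~` N) x.
have mI : measurable_fun setT (\1_(~` N) : T -> R) by exact: measurable_indic.
have mX' n : measurable_fun setT (X' n) by exact: measurable_funM.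
have mY' : measurable_fun setT Y' by exact: measurable_funM.
have absm Z : measurable_fun setT Z -> measurable_fun setT (fun x => `|Z x|%:E).
  by move=> mZ; apply/measurable_EFinP; exact: measurableT_comp.
have -> : (\int[P]_x `|Y x|%:E = \int[P]_x `|Y' x|%:E)%E.
  apply: ae_eq_integral => //; [exact: absm|exact: absm|].
  exists N; split => // x /= nE; apply: contrapT => Nx; apply: nE => _.
  by rewrite /Y' indicE mem_set ?mulr1.
have X'Y' x : X' n x @[n --> \oo] --> Y' x.
  rewrite /X' /Y' indicE; case: (boolP (x \in ~` N)) => /=.
    rewrite inE => Nx; rewrite mulr1; under eq_fun do rewrite mulr1.
    by apply: contrapT => nXY; apply: Nx; exact: XY.
  by move=> _; rewrite mulr0; under eq_fun do rewrite mulr0; exact: cvg_cst.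
have -> : (\int[P]_x `|Y' x|%:E = \int[P]_x limn_einf (fun n => `|X' n x|%:E))%E.
  apply: eq_integral => x _.
  have h : `|X' n x|%:E @[n --> \oo] --> `|Y' x|%:E.
    by apply: cvg_EFin; [near=> n|exact: cvg_norm].
  by rewrite is_cvg_limn_einfE; [rewrite (cvg_lim _ h)|apply/cvg_ex; exists (`|Y' x|%:E)].
apply: le_trans (fatou P measurableT (fun n => absm _ (mX' n)) _) _ => //.
rewrite limn_einf_lim; apply: lime_le; first exact: is_cvg_einfs.
near=> n; rewrite /einfs /=; apply: le_trans (Xc n).
apply: (@le_trans _ _ (\int[P]_x `|X' n x|%:E)%E).
  by apply: ereal_inf_lbound; exists n => //=.
apply: ge0_le_integral => //; [exact: absm|exact: absm|].
move=> x _; rewrite lee_fin /X' normrM ler_piMr // indicE.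
by case: (_ \in _); rewrite ?normr1 ?normr0.
Unshelve. all: by end_near. Qed.

Lemma bounded_dominated (X : nat -> T -> R) Y (M : R) :
  (forall n, measurable_fun setT (X n)) -> measurable_fun setT Y ->
  {ae P, forall x, X n x @[n --> \oo] --> Y x} -> (forall n x, `|X n x| <= M) ->
  (\int[P]_x `|X n x - Y x|%:E @[n --> \oo] --> 0)%E /\
  (\int[P]_x (X n x)%:E @[n --> \oo] --> \int[P]_x (Y x)%:E)%E.
Proof.
move=> mX mY XY XM.
have [|||||_ h1 h2] := @dominated_convergence _ _ _ P setT measurableT
   (fun n => EFin \o X n) (EFin \o Y) (EFin \o cst M).
- by move=> n; apply/measurable_EFinP.
- exact/measurable_EFinP.
- apply: filterS XY => x XY _; apply: cvg_EFin; first by near=> n.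
  exact: XY.
- exact: (bmf_integrable P (@bmf_cst _ T R M)).
- by apply: aeW => x n _; rewrite /= lee_fin.
by split; [exact: h1|exact: h2].
Unshelve. all: by end_near. Qed.

(** Otherwise the expectations of [f] stay [e] apart along indices whose L1 distances decay
    geometrically. Along these there is almost sure convergence, and bounded convergence contradicts
    the gap. *)
Lemma cvg_L1_distribution k (Zn : nat -> 'I_k -> T -> R) (Z : 'I_k -> T -> R) :
  (forall n i, measurable_fun setT (Zn n i)) -> (forall i, measurable_fun setT (Z i)) ->
  (forall i, (\int[P]_x `|Zn n i x - Z i x|%:E @[n --> \oo] --> 0)%E) ->
  cvg_in_distribution P (fun n x => \row_i Zn n i x) (fun x => \row_i Z i x).
Proof.
move=> mZn mZ ZnZ f cf [M fM]; rewrite unlock.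
pose a n := Ex P (fun x => f (\row_i Zn n i x)); pose b := Ex P (fun x => f (\row_i Z i x)).
have bn n : bmf (fun x => f (\row_i Zn n i x)).
  by split; [exact: measurable_continuous_row|exists M].
have b' : bmf (fun x => f (\row_i Z i x)).
  by split; [exact: measurable_continuous_row|exists M].
rewrite (_ : (fun n => _) = EFin \o a); last first.
  by apply/funext => n; exact: Ex_EFin (bn n).
rewrite (_ : (\int[P]_x _)%E = b%:E); last exact: Ex_EFin b'.
apply: cvg_EFin; first by near=> n.
apply/cvgrPdist_lt => e e0; apply: contrapT => nab.
(* The chosen indices need not increase; the geometric bound alone gives almost sure convergence. *)
have sub j : exists n, e <= `|b - a n| /\
    forall i, (\int[P]_x `|Zn n i x - Z i x|%:E <= (1 * (5 / 6) ^+ j)%:E)%E.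
  have [N _ HN] : \forall n \near \oo, forall i,
      (\int[P]_x `|Zn n i x - Z i x|%:E <= (1 * (5 / 6) ^+ j)%:E)%E.
    apply: filter_forall => i.
    have e0' : 0 < 1 * (5 / 6) ^+ j :> R by rewrite mul1r exprn_gt0 // divr_gt0.
    have /fine_cvgP[fin h] := ZnZ i.
    near=> n; have fn : (\int[P]_x `|Zn n i x - Z i x|%:E)%E \is a fin_num by near: n.
    rewrite -(fineK fn) lee_fin ltW //; near: n; exact: (cvgr_lt _ h).
  apply: contrapT => H; apply: nab; exists N => // n Nn; rewrite ltNge; apply/negP => en.
  by apply: H; exists n; split => //; exact: HN.
pose r j := projT1 (cid (sub j)).
have rP j := projT2 (cid (sub j)).
have aeZ : {ae P, forall x, forall i, Zn (r j) i x @[j --> \oo] --> Z i x}.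
  apply: filter_forall => i.
  have mg j : measurable_fun setT (fun x => Zn (r j) i x - Z i x) by exact: measurable_funB.
  apply: filterS (summable_ae ler01 mg (fun j => (rP j).2 i)) => x /cvg_series_cvg_0 h.
  apply: cvg_near_eq (cvgD (norm_cvg0 h) (cvg_cst (Z i x))); last by rewrite add0r.
  by near=> j; rewrite /= ?fctE /= subrK.
have mfZ n : measurable_fun setT (fun x => f (\row_i Zn (r n) i x)) by case: (bn (r n)).
have aefZ : {ae P, forall x, f (\row_i Zn (r j) i x) @[j --> \oo] --> f (\row_i Z i x)}.
  apply: filterS aeZ => x aeZ; apply: continuous_cvg; first exact: cf.
  exact: (cvg_row aeZ).
have [_ h] := bounded_dominated mfZ b'.1 aefZ (fun n x => fM _).
have {h} : a (r j) @[j --> \oo] --> b.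
  rewrite (Ex_EFin P b') in h; exact: fine_cvg h.
move=> h; have [N _ HN] : \forall j \near \oo, `|b - a (r j)| < e.
  by apply: cvgr_dist_lt => //; exact: h.
by have := HN N (leqnn _); rewrite /= ltNge (rP N).1.
Unshelve. all: by end_near. Qed.

End Convergence.

Section MeasurableFacts.
Variable R : realType.

Lemma measurable_inv : measurable_fun setT (@GRing.inv R).
Proof.
have mD : measurable [set x : R | x != 0] by apply: open_measurable; exact: open_neq.
have -> : setT = [set 0] `|` [set x : R | x != 0].
  by apply/seteqP; split => x //= _; case: (eqVneq x 0); [left|right].
apply/measurable_funU => //; split; first exact: measurable_fun_set1.
apply: open_continuous_measurable_fun; first exact: open_neq.
by move=> x; rewrite inE => x0; exact: inv_continuous.
Qed.

Context d (T : measurableType d).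
Implicit Types (X Y t : T -> R).

Lemma measurable_fun_div X Y : measurable_fun setT X -> measurable_fun setT Y ->
  measurable_fun setT (fun x => X x / Y x).
Proof.
move=> mX mY; apply: measurable_funM => //.
by apply: (measurableT_comp measurable_inv).
Qed.

Lemma measurable_xlnx X : measurable_fun setT X -> measurable_fun setT (fun x => xlnx (X x)).
Proof.
move=> mX; under eq_fun do rewrite xlnx_mul.
by apply: measurable_funM => //; exact: measurableT_comp.
Qed.

Lemma measurable_Cf X : measurable_fun setT X -> measurable_fun setT (fun x => Cf (X x)).
Proof.
move=> mX; apply: measurable_funD.
  apply: measurable_funD => //; apply: measurable_funM => //; exact: measurable_xlnx.
by apply: measurable_funM => //; apply: measurable_xlnx; exact: measurable_funB.
Qed.

Lemma measurable_Ctx t X : measurable_fun setT t -> measurable_fun setT X ->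
  measurable_fun setT (fun x => Ctx (t x) (X x)).
Proof.
move=> mt mX; apply: measurable_funD; first exact: measurable_Cf.
apply: measurable_funM => //; apply: measurable_fun_ifT => //.
  exact: measurable_fun_ltr.
have h Y : measurable_fun setT Y -> measurable_fun setT (fun x => xlnx (Y x)).
  exact: measurable_xlnx.
apply: measurable_funB; [apply: measurable_funB; [apply: measurable_funD|]|].
- exact: measurable_funD.
- by apply: h; exact: measurable_funB.
- by apply: h; exact: measurable_funB.
- by apply: h; exact: measurable_funB.
Qed.

End MeasurableFacts.

(** * The Quicksort process as a sum of limit tolls *)

Section TreeIdentities.
Variable R : realType.
Implicit Types (u : word -> R) (v w : word) (c : cstate R).

Lemma sum_ctermS u c M : sumVlt M.+1 (cterm u c) = ctoll c (u [::]) +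
  sumVlt M (cterm (fun w => u (false :: w)) (cstep (u [::]) false c)) +
  sumVlt M (cterm (fun w => u (true :: w)) (cstep (u [::]) true c)).
Proof. exact: sumVltS. Qed.

Lemma sumVltZ (a : R) (F : word -> R) M : sumVlt M (fun w => a * F w) = a * sumVlt M F.
Proof.
by rewrite mulr_sumr; apply: eq_bigr => j _; rewrite mulr_sumr.
Qed.

Lemma sumVlt_zero M : sumVlt M (fun=> 0) = 0 :> R.
Proof. by rewrite /sumVlt big1 // => j _; rewrite big1. Qed.

Lemma Qpart_S u v m : Qpart u v m.+1 =
  Cf (u v) + u v * Qpart u (rcons v false) m + (1 - u v) * Qpart u (rcons v true) m.
Proof.
rewrite /Qpart sumVltS /= mul1r cats0 -!sumVltZ.
by congr (_ + sumVlt _ _ + sumVlt _ _); apply/funext => w; rewrite cat_rcons mulrA.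
Qed.

Lemma Rm_S u v m t : Rm u v m.+1 t = Cv u v t +
  (if t < u v then u v * Rm u (rcons v false) m (Num.min 1 (t / u v)) else
   (1 - u v) * Rm u (rcons v true) m (Num.max 0 ((t - u v) / (1 - u v)))).
Proof.
rewrite /Rm sumVltS /= cats0 -addrA; congr (_ + _); rewrite /Top /= leNgt.
case: ifP => tu /=; rewrite sumVlt_zero ?addr0 ?add0r -sumVltZ.
  by congr sumVlt; apply/funext => w; rewrite cat_rcons.
by congr sumVlt; apply/funext => w; rewrite cat_rcons.
Qed.

Lemma cterm_dead u l f w : (forall w, 0 <= u w <= 1) -> 0 <= l -> cterm u (l, 0, f) w = 0.
Proof.
move=> u01 l0; elim: w u u01 l f l0 => [|b w IH] u u01 l f l0.
  by rewrite /cterm /= ltxx.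
have /andP[h0 h1] := u01 [::].
have p0 : 0 <= l * u [::] by rewrite mulr_ge0.
change (cterm (fun w => u (b :: w)) (cstep (u [::]) b (l, 0, f)) w = 0).
rewrite /cstep; case: b => /=.
  have -> : Num.max 0 (0 - l * u [::]) = 0 by apply/max_idPl; rewrite sub0r oppr_le0.
  by apply: IH => [w'|]; [exact: u01|rewrite subr_ge0 ler_piMr].
have -> : Num.min 0 (l * u [::]) = 0 by apply/min_idPl.
by apply: IH => [w'|//]; exact: u01.
Qed.

Lemma cterm_discarded u l s w : cterm u (l, s, Some 0%N) w = 0.
Proof.
elim: w u l s => [|b w IH] u l s; first by rewrite /cterm /= andbF.
change (cterm (fun w => u (b :: w)) (cstep (u [::]) b (l, s, Some 0%N)) w = 0).
by rewrite /cstep; case: b => /=; rewrite ?if_same IH.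
Qed.

(** A budget [k] discards nothing at depths below [k]. *)
Lemma sum_cterm_flag u l s f M : (if f is Some k then (M <= k)%N else true) ->
  sumVlt M (cterm u (l, s, f)) = sumVlt M (cterm u (l, s, None)).
Proof.
elim: M u l s f => [|M IH] u l s f fM; first by rewrite !sumVlt0.
rewrite !sum_ctermS /cstep /= if_same.
have -> : live f by case: f fM => [[|k]|].
rewrite (IH _ _ _ (dec_flag f)); last by case: f fM => [[|k]|].
congr (_ + _ + _); apply: IH.
by case: ifP; case: f fM => [[|k]|].
Qed.

(** When everything is wanted, each node with a positive rank has relative position 1, where
    [Ctx 1 y = Cf y] for labels below 1; this is the series of [Qv]. *)
Lemma sum_cterm_full u v l M : (forall w, 0 < u w < 1) -> 0 < l ->
  sumVlt M (cterm (fun w => u (v ++ w)) (l, l, None)) = l * Qpart u v M.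
Proof.
move=> u01; elim: M v l => [|M IH] v l l0; first by rewrite /Qpart !sumVlt0 mulr0.
have /andP[h0 h1] := u01 v.
have p0 : 0 < l * u v by rewrite mulr_gt0.
have p1 : 0 < l - l * u v by rewrite subr_gt0 gtr_pMr.
have shift b : (fun w => u (v ++ b :: w)) = (fun w => u (rcons v b ++ w)).
  by apply/funext => w; rewrite cat_rcons.
rewrite sum_ctermS !shift /cstep /= cats0 if_same l0 /= divff ?gt_eqF //.
have /max_idPr -> : 0 <= l - l * u v by exact: ltW.
have /min_idPr -> : l * u v <= l by rewrite -subr_ge0 ltW.
rewrite !IH // Qpart_S /Ctx (ltNge 1) (ltW h1) /= mulr0 addr0; ring.
Qed.

Definition good_labels u c := forall w, good_label (run (@cstep R) u c w) (u w).

(** At each node one child carries the target with budget [m]. To the left of a right turn the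
    subtree is kept in full and sums to the [Qv] term of [Cv]; to the right of a left turn all ranks
    are zero. *)
Lemma sum_cterm_Rm u v m l s : (forall w, 0 < u w < 1) ->
  (forall v, cvgn (Qpart u v)) -> 0 < s <= l ->
  good_labels (fun w => u (v ++ w)) (l, s, Some m) ->
  sumVlt M (cterm (fun w => u (v ++ w)) (l, s, Some m)) @[M --> \oo] --> l * Rm u v m (s / l).
Proof.
move=> u01 cQ; elim: m v l s => [|m IH] v l s /andP[s0 sl] gl.
  have -> : l * Rm u v 0 (s / l) = 0 by rewrite /Rm sumVlt0 mulr0.
  apply: cvg_near_eq (cvg_cst (0 : R)) => //; near=> M.
  rewrite [X in sumVlt M X](_ : _ = fun=> 0) ?sumVlt_zero //.
  by apply/funext => w; exact: cterm_discarded.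
have /andP[h0 h1] := u01 v.
have l0 : 0 < l by exact: lt_le_trans sl.
have p0 : 0 < l * u v by rewrite mulr_gt0.
have p1 : 0 < l - l * u v by rewrite subr_gt0 gtr_pMr.
have gv : s != l * u v by have := gl [::] s0; rewrite /= cats0.
have shift b : (fun w => u (v ++ b :: w)) = (fun w => u (rcons v b ++ w)).
  by apply/funext => w; rewrite cat_rcons.
have glb b : good_labels (fun w => u (rcons v b ++ w)) (cstep (u v) b (l, s, Some m.+1)).
  by move=> w; have := gl (b :: w); rewrite /= cats0 shift -cat_rcons.
rewrite -(cvg_shiftS (fun M => sumVlt M (cterm (fun w => u (v ++ w)) (l, s, Some m.+1)))).
rewrite Rm_S ltr_pdivrMr // (mulrC (u v) l).
have E M : sumVlt M.+1 (cterm (fun w => u (v ++ w)) (l, s, Some m.+1)) =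
  l * Ctx (s / l) (u v) +
  sumVlt M (cterm (fun w => u (rcons v false ++ w)) (cstep (u v) false (l, s, Some m.+1))) +
  sumVlt M (cterm (fun w => u (rcons v true ++ w)) (cstep (u v) true (l, s, Some m.+1))).
  by rewrite sum_ctermS !shift /= cats0 s0.
under eq_fun do rewrite E.
have gf := glb false; have gt := glb true.
rewrite /Cv ler_pdivlMr // (mulrC (u v) l).
rewrite /cstep /= in gf gt *; case: ltP gf => [sp|ps] gf.
- have /min_idPl Es : s <= l * u v by exact: ltW.
  rewrite ?Es in gf *.
  have -> : Num.max 0 (s - l * u v) = 0 by apply/max_idPl; rewrite subr_le0 ltW.
  (* The clamps in [Top] are inactive, since the relative position inside the chosen child is
     already in [0,1]. *)
  have -> : Num.min 1 (s / l / u v) = s / (l * u v).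
    rewrite -mulrA -invfM; apply/min_idPr; rewrite ler_pdivrMr // mul1r; exact: ltW.
  apply: cvg_near_eq (cvgD (cvg_cst (l * Ctx (s / l) (u v))) (IH (rcons v false) (l * u v) s _ gf)).
  + near=> M; rewrite /= ?fctE /= [X in _ = _ + X](_ : _ = 0) ?addr0 //.
    rewrite [X in sumVlt M X](_ : _ = fun=> 0) ?sumVlt_zero //.
    apply/funext => w; apply: cterm_dead; last exact: ltW.
    by move=> w'; have /andP[a b] := u01 (rcons v true ++ w'); rewrite !ltW.
  + by rewrite addr0; ring.
  + by rewrite s0 ltW.
have {}ps : l * u v < s by rewrite lt_neqAle eq_sym gv.
have /min_idPr Es : l * u v <= s by exact: ltW.
have Em : Num.max 0 (s - l * u v) = s - l * u v by apply/max_idPr; rewrite subr_ge0 ltW.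
rewrite Em in gt; rewrite ?Es Em.
have -> : Num.max 0 ((s / l - u v) / (1 - u v)) = (s - l * u v) / (l - l * u v).
  have -> : (s / l - u v) / (1 - u v) = (s - l * u v) / (l - l * u v).
    have l1 : l != 0 by rewrite gt_eqF.
    have l2 : 1 - u v != 0 by rewrite gt_eqF // subr_gt0.
    have l3 : l - l * u v != 0 by rewrite gt_eqF.
    by field; rewrite l1 l2 ?l3.
  by apply/max_idPr; rewrite divr_ge0 ?ltW // subr_gt0.
have cR : sumVlt M (cterm (fun w => u (rcons v true ++ w))
    (l - l * u v, s - l * u v, Some m)) @[M --> \oo] -->
    (l - l * u v) * Rm u (rcons v true) m ((s - l * u v) / (l - l * u v)).
  by apply: IH => //; rewrite subr_gt0 ps lerB.
have cL : sumVlt M (cterm (fun w => u (rcons v false ++ w))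
    (l * u v, l * u v, None)) @[M --> \oo] --> l * u v * Qv u (rcons v false).
  under eq_fun do rewrite sum_cterm_full //.
  by apply: cvgM; [exact: cvg_cst|exact: cQ].
apply: cvg_near_eq (cvgD (cvgD (cvg_cst (l * Ctx (s / l) (u v))) cL) cR).
  by near=> M.
rewrite !mulrDr !mulrA; congr (_ + _ + _); ring.
Unshelve. all: by end_near. Qed.

End TreeIdentities.

(** * Measurability of the limit expansion in the labels *)

Section TreeMeasurability.
Context d (T : measurableType d) (R : realType).
Implicit Types (V : word -> T -> R) (X : T -> R).

Lemma measurable_sumVlt (F : word -> T -> R) m : (forall w, measurable_fun setT (F w)) ->
  measurable_fun setT (fun x => sumVlt m (fun w => F w x)).
Proof. by move=> mF; apply: measurable_sum => j; exact: measurable_sum. Qed.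

Lemma measurable_cterm w V (l s : T -> R) f : (forall v, measurable_fun setT (V v)) ->
  measurable_fun setT l -> measurable_fun setT s ->
  measurable_fun setT (fun x => cterm (fun v => V v x) (l x, s x, f) w).
Proof.
elim: w V l s f => [|b w IH] V l s f mV ml ms.
  rewrite /cterm /=; apply: measurable_fun_ifT => //.
    apply: measurable_and => //; exact: measurable_fun_ltr.
  apply: measurable_funM => //; apply: measurable_Ctx => //.
  exact: measurable_fun_div.
have mp : measurable_fun setT (fun x => l x * V [::] x) by exact: measurable_funM.
have mVb v : measurable_fun setT (V (b :: v)) by [].
case: b mVb => mVb.
  rewrite [X in measurable_fun _ X](_ : _ = fun x => cterm (fun v => V (true :: v) x)
    (l x - l x * V [::] x, Num.max 0 (s x - l x * V [::] x), dec_flag f) w) //.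
  apply: (IH (fun v => V (true :: v))) => //; first exact: measurable_funB.
  apply: measurable_maxr => //; exact: measurable_funB.
rewrite [X in measurable_fun _ X](_ : _ = fun x => if s x < l x * V [::] x then
  cterm (fun v => V (false :: v) x)
    (l x * V [::] x, Num.min (s x) (l x * V [::] x), dec_flag f) w else
  cterm (fun v => V (false :: v) x)
    (l x * V [::] x, Num.min (s x) (l x * V [::] x), full_flag f) w);
    last first.
  apply/funext => x.
  rewrite -[LHS]/(cterm (fun v => V (false :: v) x) (cstep (V [::] x) false (l x, s x, f)) w).
  by rewrite /cstep /=; case: ifP.
have mm : measurable_fun setT (fun x => Num.min (s x) (l x * V [::] x)).
  exact: measurable_minr.
apply: measurable_fun_ifT; first exact: measurable_fun_ltr.
  exact: (IH (fun v => V (false :: v))).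
exact: (IH (fun v => V (false :: v))).
Qed.

Lemma measurable_ell V v w : (forall v, measurable_fun setT (V v)) ->
  measurable_fun setT (fun x => ell (fun v => V v x) v w).
Proof.
move=> mV; elim: w v => [|b w IH] v //=.
by apply: measurable_funM => //; case: b => //; exact: measurable_funB.
Qed.

Lemma measurable_Qv V v : (forall v, measurable_fun setT (V v)) ->
  measurable_fun setT (fun x => Qv (fun v => V v x) v).
Proof.
move=> mV; apply: measurable_limn => m; apply: measurable_sumVlt => w.
by apply: measurable_funM; [exact: measurable_ell|exact: measurable_Cf].
Qed.

Lemma measurable_Cv V v X : (forall v, measurable_fun setT (V v)) -> measurable_fun setT X ->
  measurable_fun setT (fun x => Cv (fun v => V v x) v (X x)).
Proof.
move=> mV mX; apply: measurable_funD; first exact: measurable_Ctx.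
apply: measurable_fun_ifT => //; first exact: measurable_fun_ler.
by apply: measurable_funM => //; exact: measurable_Qv.
Qed.

Lemma measurable_Lop V v w (h : T -> R -> R) X : (forall v, measurable_fun setT (V v)) ->
  (forall Y, measurable_fun setT Y -> measurable_fun setT (fun x => h x (Y x))) ->
  measurable_fun setT X ->
  measurable_fun setT (fun x => Lop (fun v => V v x) v w (h x) (X x)).
Proof.
move=> mV mh; elim: w v X => [|b w IH] v X mX /=; first exact: mh.
rewrite /Top; case: b => /=.
  apply: measurable_fun_ifT => //; first exact: measurable_fun_ler.
  apply: measurable_funM; first exact: measurable_funB.
  apply: (IH (rcons v true) (fun x => Num.max 0 ((X x - V v x) / (1 - V v x)))).
  apply: measurable_maxr => //; apply: measurable_fun_div; exact: measurable_funB.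
apply: measurable_fun_ifT => //; first exact: measurable_fun_ltr.
apply: measurable_funM => //.
apply: (IH (rcons v false) (fun x => Num.min 1 (X x / V v x))).
by apply: measurable_minr => //; exact: measurable_fun_div.
Qed.

Lemma measurable_Rm V v m X : (forall v, measurable_fun setT (V v)) ->
  measurable_fun setT X -> measurable_fun setT (fun x => Rm (fun v => V v x) v m (X x)).
Proof.
move=> mV mX; apply: measurable_sumVlt => w.
apply: (@measurable_Lop V v w (fun x => Cv (fun v => V v x) (v ++ w))) => // Y mY.
exact: measurable_Cv.
Qed.

Lemma measurable_Yq V t : (forall v, measurable_fun setT (V v)) ->
  measurable_fun setT (Yq V t).
Proof.
by move=> mV; apply: measurable_limn => m; exact: (measurable_Rm _ _ mV (measurable_cst t)).
Qed.

End TreeMeasurability.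

(** * Convergence of the processes *)

Section LimitProcess.
Context d (T : measurableType d) (R : realType) (P : probability T R).

Lemma ae_forall_countable (C : countType) (Q : C -> T -> Prop) :
  (forall c, {ae P, forall x, Q c x}) -> {ae P, forall x, forall c, Q c x}.
Proof.
move=> aeQ.
have := @ae_foralln _ _ _ P (fun n x => if unpickle n is Some c then Q c x else True).
move=> H; apply: filterS (H _) => [x Qx c|n].
  by have := Qx (pickle c); rewrite pickleK.
by case: unpickle => [c|]; [exact: aeQ|exact: aeW].
Qed.

Lemma iid_uniform_subtree (U : word -> T -> R) v :
  iid_uniform P U -> iid_uniform P (fun w => U (v ++ w)).
Proof.
move=> [mU [UL UI]]; split; [|split] => [w|w|s B us mB]; [exact: mU|exact: UL|].
pose B' w := B (drop (size v) w).
have dv w : drop (size v) (v ++ w) = w by rewrite drop_size_cat.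
have := UI [seq v ++ w | w <- s] B'.
rewrite map_inj_uniq; last by move=> w w' /(congr1 (drop (size v))); rewrite !dv.
move=> /(_ us (fun w => mB _)); rewrite big_map.
under [in X in _ = X -> _]eq_bigr do rewrite /B' dv.
move=> <-; congr (P _); apply/seteqP; split => x H w /=.
  by move=> /mapP[w' ws ->]; rewrite /B' dv; exact: H.
by move=> ws; have := H (v ++ w); rewrite /= /B' dv; apply; exact: map_f.
Qed.

Variable U : word -> T -> R.
Hypothesis UP : iid_uniform P U.

Let mU v : measurable_fun setT (U v). Proof. by have [+ _] := UP; exact. Qed.

Lemma ae_label01 : {ae P, forall x, forall v, 0 < U v x < 1}.
Proof.
apply: (@ae_forall_countable (seq bool) (fun v x => 0 < U v x < 1)) => v.
have mA : measurable (U v @^-1` `]0, 1[%classic).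
  by apply: (measurable_label UP); exact: measurable_itv.
have PA : P (U v @^-1` `]0, 1[%classic) = 1%E.
  have [_ [UL _]] := UP; rewrite UL // (_ : _ `&` _ = `]0, 1[%classic).
    by rewrite lebesgue_measure_itv /= lte_fin ltr01 sube0.
  apply/seteqP; split => y /=; rewrite !in_itv /=; first by case.
  by move=> /andP[y0 y1]; rewrite y0 y1 !ltW.
exists (~` (U v @^-1` `]0, 1[%classic)); split.
- exact: measurableC.
- by rewrite probability_setC // PA subee.
- by move=> x /= nx; contradict nx; move: nx; rewrite /= in_itv.
Qed.

(** * Ranks stay away from split points *)

Section Separation.
Variables (t : R) (f : option nat).
Hypothesis t01 : 0 <= t <= 1.

Let a n w x := dst U (start t n f) w x.
Let close (e : R) n w := [set x | (0 < (a n w x).1.2)%N &&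
  (`|(a n w x).1.2%:R - (a n w x).1.1%:R * U w x| <= e * (a n w x).1.1%:R)].

Let closeE e n w : close e n w = [set x | (0 < (a n w x).1.2%:R :> R) &&
  (`|(a n w x).1.2%:R - (a n w x).1.1%:R * U w x| <= e * (a n w x).1.1%:R)].
Proof. by apply/seteqP; split => x /=; rewrite ltr0n. Qed.

Let measurable_close e n w : measurable (close e n w).
Proof.
have [m1 _] := bmf_dst UP (start t n f) w (fun s => s.1.1%:R).
have [m2 _] := bmf_dst UP (start t n f) w (fun s => s.1.2%:R).
pose g x := (0 < (a n w x).1.2%:R :> R) &&
  (`|(a n w x).1.2%:R - (a n w x).1.1%:R * U w x| <= e * (a n w x).1.1%:R).
suff mg : measurable_fun setT g.
  by rewrite closeE -[X in measurable X]setTI; exact: (mg measurableT [set true]).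
apply: measurable_and; first exact: measurable_fun_ltr.
apply: measurable_fun_ler; last exact: measurable_funM.
apply: measurableT_comp => //; apply: measurable_funB => //.
exact: measurable_funM.
Qed.

(** Given the state, the event confines [U w] to an interval of half-width [e]. The bound is uniform
    in [n], which the limiting argument needs. *)
Let Pr_close e n w : 0 <= e -> Pr P (close e n w) <= 2 * e.
Proof.
move=> e0.
pose B (s : dstate) := if (0 < s.1.2)%N then
  [set y : R | `|s.1.2%:R - s.1.1%:R * y| <= e * s.1.1%:R] else set0.
have BE (s : dstate) : (0 < s.1.2 <= s.1.1)%N ->
    B s = [set y : R | (`|y - s.1.2%:R / s.1.1%:R| <= e)%R].
  move=> /andP[s0 sl]; have s1 : 0 < s.1.1%:R :> R by rewrite ltr0n; lia.
  rewrite /B s0; apply/seteqP.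
  have E (y : R) : `|s.1.2%:R - s.1.1%:R * y| = `|y - s.1.2%:R / s.1.1%:R| * s.1.1%:R.
    have := normrM (y - s.1.2%:R / s.1.1%:R) (s.1.1%:R : R); rewrite (gtr0_norm s1) => <-.
    by rewrite mulrBl divfK ?gt_eqF // distrC (mulrC y).
  by split => y /=; rewrite E ler_pM2r.
have mB s : measurable (B s).
  rewrite /B; case: ifP => // _.
  pose g (y : R) := `|s.1.2%:R - s.1.1%:R * y| <= e * s.1.1%:R.
  suff mg : measurable_fun setT g.
    by rewrite -[X in measurable X]setTI; exact: (mg measurableT [set true]).
  apply: measurable_fun_ler => //; apply: measurableT_comp => //.
  by apply: measurable_funB => //; exact: measurable_funM.
have := cond_label UP (start t n f) (nodep_cst U w 1) mB.
rewrite (_ : (fun x => cst 1 x * \1_(B (dst U (start t n f) w x)) (U w x)) =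
  \1_(close e n w) :> (T -> R)).
  rewrite Ex_indic // => ->; rewrite -[leRHS](Ex_cst P); apply: Ex_le.
  - apply: bmfM; first exact: bmf_cst.
    exact: (bmf_dst UP _ _ (fun s => Pr P (U w @^-1` B s))).
  - exact: bmf_cst.
  move=> x; rewrite mul1r; have := dst_le U w x (start_le n f t01).
  move: (dst U _ w x) => s sl; have [s0|s0] := posnP s.1.2.
    by rewrite /B s0 ltnn preimage_set0 /Pr measure0 mulr_ge0.
  by rewrite BE ?s0 //; exact: (Pr_label_close UP).
apply/funext => x; rewrite mul1r !indicE; congr (nat_of_bool _)%:R.
rewrite /B -/(a n w x); apply/idP/idP.
  by case: ifP => [s0|_]; rewrite !inE // /close /= s0.
by rewrite !inE /close /= => /andP[-> ].
Qed.

(** [D k] says that rank and pivot are [e k]-close for all large [n]. An increasing union of events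
    of probability at most [2 * e k], it obeys the same bound, so the exceptional set, lying in
    every [D k], is null. *)
Lemma ae_far w : {ae P, forall x, exists2 e : R, 0 < e & forall N, exists2 n, (N <= n)%N &
  ~~ ((0 < (a n w x).1.2)%N &&
    (`|(a n w x).1.2%:R - (a n w x).1.1%:R * U w x| <= e * (a n w x).1.1%:R))}.
Proof.
pose e k : R := k.+1%:R^-1.
pose C k N := \bigcap_n close (e k) (N + n)%N w.
pose D k := \bigcup_N C k N.
have e0 k : 0 < e k by rewrite invr_gt0.
have mC k N : measurable (C k N) by apply: bigcapT_measurable => n; exact: measurable_close.
have mD k : measurable (D k) by exact: bigcupT_measurable.
have PC k N : (P (C k N) <= (2 * e k)%:E)%E.
  apply: (@le_trans _ _ (P (close (e k) (N + 0)%N w))).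
    apply: le_measure; [exact/mem_set/mC|exact/mem_set/measurable_close|].
    by move=> x; apply.
  have := @Pr_close (e k) (N + 0)%N w (ltW (e0 k)); rewrite -lee_fin fineK //.
  by apply: fin_num_measure; exact: measurable_close.
have PD k : (P (D k) <= (2 * e k)%:E)%E.
  have h : (P \o C k) n @[n --> \oo] --> P (D k).
    apply: nondecreasing_cvg_mu; [exact: mC|exact: mD|].
    move=> N M NM; apply/subsetPset => x Cx n _.
    have := Cx (M - N + n)%N I; by rewrite addnA subnKC.
  rewrite -(cvg_lim _ h) //; apply: lime_le; first by apply/cvg_ex; exists (P (D k)).
  by near=> N; exact: PC.
exists (\bigcap_k D k); split.
- exact: bigcapT_measurable.
- apply/eqP; rewrite eq_le measure_ge0 andbT.
  have h : (2 * e k)%:E @[k --> \oo] --> (2 * 0 : R)%:E.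
    apply: cvg_EFin; first by near=> k.
    by apply: cvgM; [exact: cvg_cst|exact: cvg_harmonic].
  rewrite mulr0 in h.
  rewrite (_ : 0%E = limn (fun k => (2 * e k)%:E)); last by rewrite (cvg_lim _ h).
  apply: lime_ge; first by apply/cvg_ex; exists 0%E.
  near=> k; apply: le_trans (PD k); apply: le_measure; rewrite ?inE //.
    exact: bigcapT_measurable.
  by move=> x; apply.
move=> x /= nx k _; apply: contrapT => nD; apply: nx; exists (e k) => // N.
apply: contrapT => nN; apply: nD; exists N => // n _.
apply: contrapT => nc; apply: nN; exists (N + n)%N; first exact: leq_addr.
by apply/negP.
Unshelve. all: by end_near. Qed.

End Separation.

Section Fixed.
Variable t : R.
Hypothesis t0 : 0 < t <= 1.

Let t01 : 0 <= t <= 1. Proof. by case/andP: t0 => /ltW -> ->. Qed.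

Definition partial_limit f m x : R := sumVlt m (cterm (fun v => U v x) (1, t, f)).

Lemma measurable_partial_limit f m : measurable_fun setT (partial_limit f m).
Proof.
by apply: measurable_sumVlt => w; exact: (@measurable_cterm _ _ _ w U (cst 1) (cst t) f).
Qed.

Lemma ae_partial_limit f : {ae P, forall x,
  (forall m, sumVlt m (fun w => dtm U (start t n f) w x) / n%:R @[n --> \oo]
    --> partial_limit f m x)
  /\ good_labels (fun v => U v x) (1, t, f)}.
Proof.
apply: filterS2 ae_label01 (ae_forall_countable (C := seq bool) (fun w => ae_far f t01 w)).
move=> x u01 far; have sc := start_cvg f t0.
split=> [m|w]; first exact: (sum_dterm_cvg u01 sc far).
by have [_] := run_cvg u01 sc far w.
Qed.

Lemma partial_limit_L1 f m M : (m <= M)%N ->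
  (\int[P]_x `|partial_limit f M x - partial_limit f m x|%:E <=
   (tail_const R * (5 / 6) ^+ m)%:E)%E.
Proof.
move=> mM.
(* The shift of the index keeps the initial length positive. *)
pose X n x : R := n.+1%:R^-1 * tail_sum U (start t n.+1 f) m M x.
have bX n : bmf (X n) by apply: bmfZ; exact: (bmf_tail_sum UP).
apply: (@fatou_abs _ _ _ P X) => [n|||n].
- by case: (bX n).
- by apply: measurable_funB; exact: measurable_partial_limit.
- apply: filterS (ae_partial_limit f) => x [h _].
  have := cvgB (h M) (h m).
  move=> H; have {}H : (sumVlt M (fun w => dtm U (start t n f) w x) / n%:R -
    sumVlt m (fun w => dtm U (start t n f) w x) / n%:R) @[n --> \oo] -->
    partial_limit f M x - partial_limit f m x by exact: H.
  rewrite -cvg_shiftS in H; apply: cvg_near_eq H => //.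
  near=> n; rewrite -mulrBl (sumVlt_tail _ _ _ mM) addrC addKr mulrC //.
rewrite Ex_EFin; last exact: bmf_abs.
rewrite lee_fin /X.
under [X in Ex P X]eq_fun do rewrite normrM ger0_norm ?invr_ge0 //.
rewrite ExZ; last by apply: bmf_abs; exact: (bmf_tail_sum UP).
rewrite mulrC ler_pdivrMr ?ltr0n //.
by apply: (le_trans (Ex_tail_sum UP _ _ _)) => //; exact: start_le.
Unshelve. all: by end_near. Qed.

Lemma tail_const_ge0 : 0 <= tail_const R.
Proof. by rewrite /tail_const addr_ge0 // mulr_ge0 // sqr_const_ge0. Qed.

Lemma ae_partial_limit_cvg : {ae P, forall x, cvgn (fun m => partial_limit None m x)}.
Proof.
pose g m x := partial_limit None m.+1 x - partial_limit None m x.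
have mg m : measurable_fun setT (g m).
  by apply: measurable_funB; exact: measurable_partial_limit.
have := summable_ae tail_const_ge0 mg (fun m => @partial_limit_L1 None m m.+1 (leqnSn m)).
apply: filterS => x /normed_cvg.
rewrite (_ : (fun m => g m x) = telescope (fun m => partial_limit None m x)) // telescopeK.
move=> /cvg_ex[l h]; apply/cvg_ex; exists (l + partial_limit None 0 x).
apply: cvg_near_eq (cvgD h (cvg_cst (partial_limit None 0 x))) => //.
by near=> m; rewrite /= ?fctE /= subrK.
Unshelve. all: by end_near. Qed.

End Fixed.

End LimitProcess.

Section Conclusion.
Context d (T : measurableType d) (R : realType) (P : probability T R).
Variable U : word -> T -> R.
Hypothesis UP : iid_uniform P U.

(** [Qpart] at [v] is the limit toll sum at [t = 1] for the subtree of [v], whose labels are again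
    i.i.d. uniform; there are countably many words. *)
Lemma ae_Qpart_cvg : {ae P, forall x, forall v, cvgn (Qpart (fun w => U w x) v)}.
Proof.
apply: (@ae_forall_countable _ _ _ P (seq bool) (fun v x => cvgn (Qpart (fun w => U w x) v))) => v.
have one01 : 0 < (1 : R) <= 1 by rewrite ltr01 lexx.
apply: filterS2 (ae_label01 UP) (ae_partial_limit_cvg (iid_uniform_subtree v UP) one01).
move=> x u01.
rewrite (_ : (fun m => _) = Qpart (fun w => U w x) v) //; apply/funext => m.
by have := @sum_cterm_full _ (fun w => U w x) v 1 m u01 ltr01; rewrite mul1r => <-.
Qed.

Variable t : R.
Hypothesis t0 : 0 < t <= 1.

Let t01 : 0 <= t <= 1. Proof. by case/andP: t0 => /ltW -> ->. Qed.
Let mU v : measurable_fun setT (U v). Proof. by have [+ _] := UP; exact. Qed.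

Local Notation A := (partial_limit U t).
Local Notation Rmt m x := (Rm (fun v => U v x) [::] m t).
Local Notation K := (tail_const R).

Let mA f m : measurable_fun setT (A f m) := measurable_partial_limit UP t f m.

Let mR m : measurable_fun setT (fun x => Rmt m x).
Proof. exact: (measurable_Rm _ _ mU (measurable_cst t)). Qed.

Lemma ae_Rm m : {ae P, forall x, A (Some m) M x @[M --> \oo] --> Rmt m x}.
Proof.
apply: (@filterS3 _ _ _ _ _ _ _ _ (ae_label01 UP) ae_Qpart_cvg (ae_partial_limit UP t0 (Some m))).
move=> x u01 cQ [_ gl].
by have := @sum_cterm_Rm _ (fun v => U v x) [::] m 1 t u01 cQ t0 gl; rewrite mul1r divr1.
Qed.

Lemma A_flag m x : A (Some m) m x = A None m x.
Proof. exact: sum_cterm_flag. Qed.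

(** By [A_flag] the flagged and the depth-[m] sums agree on the first [m] levels, so their
    difference is a limit of flagged tails, covered by the uniform tail bound. *)
Lemma Rm_L1 m : (\int[P]_x `|Rmt m x - A None m x|%:E <= (K * (5 / 6) ^+ m)%:E)%E.
Proof.
apply: (@fatou_abs _ _ _ P (fun M x => A (Some m) (M + m)%N x - A (Some m) m x)) => [M|||M].
- exact: measurable_funB.
- exact: measurable_funB.
- apply: filterS (ae_Rm m) => x h; rewrite -A_flag; apply: cvgB; last exact: cvg_cst.
  by rewrite (cvg_shiftn m (fun M => A (Some m) M x)).
exact: partial_limit_L1 (leq_addl _ _).
Qed.

(** The differences between [Rm] and the depth truncations are almost surely summable. Hence the
    limit defining [Yq] exists and is the limit of the depth truncations. *)
Lemma ae_Yq : {ae P, forall x, A None m x @[m --> \oo] --> Yq U t x}.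
Proof.
have mg m : measurable_fun setT (fun x => Rmt m x - A None m x) by exact: measurable_funB.
apply: filterS2 (ae_partial_limit_cvg UP t0) (summable_ae (tail_const_ge0 R) mg Rm_L1).
move=> x /cvg_ex[l Al] /cvg_series_cvg_0 /norm_cvg0 RA.
have Rl : Rmt m x @[m --> \oo] --> l.
  apply: cvg_near_eq (cvgD RA Al); last by rewrite add0r.
  by near=> m; rewrite /= ?fctE /= subrK.
rewrite /Yq /Yproc (cvg_lim _ Rl) //; exact: Al.
Unshelve. all: by end_near. Qed.

Let mY : measurable_fun setT (Yq U t) := measurable_Yq t mU.

Lemma Yq_L1 m : (\int[P]_x `|Yq U t x - A None m x|%:E <= (K * (5 / 6) ^+ m)%:E)%E.
Proof.
apply: (@fatou_abs _ _ _ P (fun M x => A None (M + m)%N x - A None m x)) => [M|||M].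
- exact: measurable_funB.
- exact: measurable_funB.
- apply: filterS ae_Yq => x h; apply: cvgB; last exact: cvg_cst.
  by rewrite (cvg_shiftn m (fun M => A None M x)).
exact: partial_limit_L1 (leq_addl _ _).
Qed.

Lemma ge0_cvg_ereal0 (u : nat -> \bar R) : (forall n, (0 <= u n)%E) ->
  (forall e : R, 0 < e -> \forall n \near \oo, (u n <= e%:E)%E) ->
  u n @[n --> \oo] --> 0%E.
Proof.
move=> u0 ue.
have fin : \forall n \near \oo, u n \is a fin_num.
  apply: filterS (ue 1 ltr01) => n un.
  by rewrite ge0_fin_numE // (le_lt_trans un) // ltry.
apply/fine_cvgP; split => //; apply/cvgr0Pnorm_le => e e0; near=> n.
have fn : u n \is a fin_num by near: n.
rewrite /= ger0_norm ?fine_ge0 // -lee_fin fineK //; near: n; exact: ue.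
Unshelve. all: by end_near. Qed.

Lemma Yn_cvg_L1 : (\int[P]_x `|Yn P U n t x - Yq U t x|%:E @[n --> \oo] --> 0)%E.
Proof.
apply: ge0_cvg_ereal0 => [n|e e0].
  by apply: integral_ge0 => x _; rewrite lee_fin.
have K0 := tail_const_ge0 R.
(* One level [m], independent of [n], makes the tails of both processes smaller than [e / 3]. *)
have [m Km] : exists m, K * (5 / 6) ^+ m < e / 3.
  have h : K * (5 / 6) ^+ m @[m --> \oo] --> K * 0.
    apply: cvgM; first exact: cvg_cst.
    by apply: cvg_expr; rewrite ger0_norm ?divr_ge0 // ltr_pdivrMr // mul1r ltr_nat.
  have [N _ HN] : \forall m \near \oo, K * (5 / 6) ^+ m < e / 3.
    by apply: (cvgr_lt _ h); rewrite mulr0 divr_gt0.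
  by exists N; exact: (HN N (leqnn N)).
pose S n x : R := sumVlt m (fun w => dtm U (start t n None) w x) / n%:R.
have bS n : bmf (S n).
  rewrite [X in bmf X](_ : _ = fun x => n%:R^-1 * sumVlt m (fun w => dtm U (start t n None) w x)).
    by apply: bmfZ; exact: (bmf_sumVlt_dtm UP).
  by apply/funext => x; rewrite /S mulrC.
have aeS : {ae P, forall x, S n x @[n --> \oo] --> A None m x}.
  by apply: filterS (ae_partial_limit UP t0 None) => x [+ _]; apply.
have Sbound n x : `|S n x| <= sumVlt m (fun=> 75).
  rewrite /S normrM [`|n%:R^-1|]ger0_norm ?invr_ge0 //.
  have := sumVlt_dtm_bound U m x (start_le n None t01); rewrite /start /= => h.
  have [->|n0] := posnP n.
    by rewrite invr0 mulr0; apply: sumr_ge0 => j _; exact: sumr_ge0.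
  by rewrite ler_pdivrMr ?ltr0n.
(* For fixed [m] the normalized tolls are bounded uniformly in [n], so almost sure convergence
   becomes L1 convergence. *)
have [SA _] := bounded_dominated (fun n => (bS n).1) (mA None m) aeS Sbound.
have /fine_cvgP[finS h] := SA.
near=> n; have n0 : (0 < n)%N by near: n; exact: nbhs_infty_gt.
have absm (Z : T -> R) : measurable_fun setT Z -> measurable_fun setT (fun x => `|Z x|%:E).
  by move=> mZ; apply/measurable_EFinP; exact: measurableT_comp.
have [mYn _] := bmf_Yn UP n t01.
have m1 : measurable_fun setT (fun x => Yn P U n t x - S n x).
  by apply: measurable_funB => //; exact: (bS n).1.
have m2 : measurable_fun setT (fun x => S n x - A None m x).
  by apply: measurable_funB => //; exact: (bS n).1.
have m3 : measurable_fun setT (fun x => Yq U t x - A None m x) by exact: measurable_funB.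
apply: (@le_trans _ _ (\int[P]_x (`|Yn P U n t x - S n x|%:E + (`|S n x - A None m x|%:E +
    `|Yq U t x - A None m x|%:E)))%E).
  apply: ge0_le_integral => //.
  - by apply: absm; exact: measurable_funB.
  - by apply: emeasurable_funD; [exact: absm|apply: emeasurable_funD; exact: absm].
  - move=> x _; rewrite -!EFinD lee_fin.
    rewrite -(subrKA (S n x)) (le_trans (ler_normD _ _)) // lerD2l.
    by rewrite -(subrKA (A None m x)) (le_trans (ler_normD _ _)) // lerD2l distrC.
rewrite ge0_integralD //; [|exact: absm|by move=> x _; rewrite adde_ge0|];
  last by apply: emeasurable_funD; exact: absm.
rewrite ge0_integralD //; [|exact: absm|exact: absm].
have h1 : (\int[P]_x `|Yn P U n t x - S n x|%:E <= (e / 3)%:E)%E.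
  rewrite Ex_EFin; last by apply: bmf_abs; split=> //; have [_ [M1 HM1]] := bmf_Yn UP n t01;
    have [_ [M2 HM2]] := bS n; exists (M1 + M2) => x; rewrite (le_trans (ler_normB _ _)) // lerD.
  by rewrite lee_fin (le_trans (Ex_Yn_tail UP m t01 n0)) // ltW.
have h2 : (\int[P]_x `|S n x - A None m x|%:E <= (e / 3)%:E)%E.
  have fn : (\int[P]_x `|S n x - A None m x|%:E)%E \is a fin_num by near: n.
  rewrite -(fineK fn) lee_fin ltW //; near: n; apply: (cvgr_lt _ h); exact: divr_gt0.
have h3 : (\int[P]_x `|Yq U t x - A None m x|%:E <= (e / 3)%:E)%E.
  by apply: le_trans (Yq_L1 m) _; rewrite lee_fin ltW.
apply: le_trans (leeD h1 (leeD h2 h3)) _; rewrite -!EFinD lee_fin; lra.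
Unshelve. all: by end_near. Qed.

End Conclusion.

Theorem theorem2 (R : realType) (d : measure_display) (T : measurableType d)
  (P : probability T R) (U : word -> T -> R) :
  iid_uniform P U ->
  forall (k : nat) (t : 'I_k -> R), (forall i, 0 < t i <= 1) ->
  cvg_in_distribution P
    (fun n x => \row_(i < k) Yn P U n (t i) x)
    (fun x => \row_(i < k) Yq U (t i) x).
Proof.
move=> UP k t t01; have mU v : measurable_fun setT (U v) by have [+ _] := UP; exact.
(* All coordinates share the labels [U], so coordinatewise L1 convergence gives the joint
   statement. *)
apply: (@cvg_L1_distribution _ _ _ P k (fun n i => Yn P U n (t i)) (fun i => Yq U (t i))).
- move=> n i; have ti : 0 <= t i <= 1 by case/andP: (t01 i) => /ltW -> ->.
  by have [] := bmf_Yn UP n ti.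
- by move=> i; exact: measurable_Yq.
- by move=> i; exact: Yn_cvg_L1.
Qed.
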